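(* Let $A\ge1$, $\gamma>1$ and $\epsilon\ge 0$. There exists a constant $C_1=C_1(A,\gamma,\epsilon)>0$, depending only on these parameters, such that the following holds. Let $0\le T_1<T_2\le\infty$, let $x_1,x_2\in\mathbb V$, and let $f_1,f_2:\mathbb R_+\to\mathbb R_+$ satisfy $\mathbb P_{x_i}(X_t=x_i)\le 1/f_i(t)$ for all $t\ge0$, $i=1,2$. If each $f_i$ is $(A,\gamma)$-regular on $[T_1,T_2)$ and satisfies $$f_i(t)\le A t^{\epsilon}\qquad\text{for all } t\in[T_1,T_2),$$ then for each $t\in[\widetilde T_1,T_2)$ with $t>0$, $$\mathbb P_{x_1}(X_t=x_2)\le\frac{C_1(\nu_{x_2}/\nu_{x_1})^{1/2}}{\sqrt{f_1\left(\frac{t}{2\gamma}\right)f_2\left(\frac{t}{2\gamma}\right)}}\exp\left(-\theta\,\frac{d_\nu(x_1,x_2)^2}{t}\right),$$ where $\theta=10^{-7}$ and $\widetilde T_1=\max\{2^{10}\epsilon\,T_1\log(\max\{T_1,1\}),\ d_\nu(x_1,x_2)\}$.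
   Context: $\mathbb R_+=[0,\infty)$; $0^0=1$. $\Gamma=(\mathbb V,\mathbb E)$ is a connected, locally finite graph (finite or infinite) without double edges; $x\sim y$ means $(x,y)\in\mathbb E$. $\mu$ is an edge weight: $\mu_{xy}=\mu_{yx}>0$ if $(x,y)\in\mathbb E$ and $\mu_{xy}=0$ otherwise. $\nu_x>0$ is given for each $x\in\mathbb V$. $X=(X_t)_{t\ge0}$ is the (minimal, i.e. killed at explosion) continuous time random walk on $\mathbb V$ with generator $\mathscr L f(x)=\frac1{\nu_x}\sum_{y\in\mathbb V}(f(y)-f(x))\mu_{xy}$, and $\mathbb P_x$ is its law when started from $x$. $d_\nu$ is a metric on $\mathbb V$ such that $\frac1{\nu_x}\sum_y d_\nu(x,y)^2\mu_{xy}\le 1$ for all $x\in\mathbb V$, and $d_\nu(x,y)\le 1$ whenever $x\sim y$. A function $f:\mathbb R_+\to\mathbb R_+$ is $(A,\gamma)$-regular on $[a,b)$ if it is non-decreasing on all of $\mathbb R_+$ and $\frac{f(\gamma s)}{f(s)}\le A\frac{f(\gamma t)}{f(t)}$ for all $a\le s<t<\gamma^{-1}b$. Conventions: $f$ is positive on $(0,\infty)$; $1/0=+\infty$; if $f(0)=0$, the inequality with $s=0$ is read in cross-multiplied form $f(\gamma s)f(t)\le A f(\gamma t)f(s)$. *)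

(* Defs.v *)
From HB Require Import structures.
From mathcomp Require Import all_boot all_order all_algebra.
From mathcomp Require Import all_classical all_reals all_analysis.
From mathcomp Require Import measurable_realfun.

Set Implicit Arguments.
Unset Strict Implicit.
Unset Printing Implicit Defensive.
Import Order.TTheory GRing.Theory Num.Theory.
Import numFieldNormedType.Exports.

Local Open Scope classical_set_scope.
Local Open Scope ring_scope.

(* The edge set is a relation, so there are no double edges.  Loops are not
   excluded; they do not contribute to the generator below. *)
Definition locally_finite_connected_graph (V : choiceType) (E : rel V) : Prop :=
  [/\ symmetric E,
      forall x : V, finite_set [set y | E x y]
    & forall x y : V, exists p : seq V, path E x p /\ last x p = y].

Definition edge_weight (R : realType) (V : choiceType) (E : rel V)
    (mu : V -> V -> R) : Prop :=
  [/\ forall x y, mu x y = mu y x,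
      forall x y, E x y -> 0 < mu x y
    & forall x y, ~~ E x y -> mu x y = 0].

(* \sum_(y \in A) is the sum of a finitely supported family; in a locally
   finite graph only the neighbours y of x contribute. *)
Definition generator (R : realType) (V : choiceType) (mu : V -> V -> R)
    (nu : V -> R) (f : V -> R) (x : V) : R :=
  (nu x)^-1 * \sum_(y \in [set: V]) ((f y - f x) * mu x y).

(* Entry (x, y) of the generator seen as a matrix: L 1_{y} (x). *)
Definition Qmatrix (R : realType) (V : choiceType) (mu : V -> V -> R)
    (nu : V -> R) (x y : V) : R :=
  generator mu nu (fun z => (z == y)%:R) x.

Definition jump_rate (R : realType) (V : choiceType) (mu : V -> V -> R)
    (nu : V -> R) (x : V) : R :=
  - Qmatrix mu nu x x.

(* If the jump rate at x is 0 (the graph is then a single vertex), x is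
   absorbing. *)
Definition jump_prob (R : realType) (V : choiceType) (mu : V -> V -> R)
    (nu : V -> R) (x y : V) : R :=
  if jump_rate mu nu x == 0 then (y == x)%:R
  else if y == x then 0
  else Qmatrix mu nu x y / jump_rate mu nu x.

(* Time of the n-th jump, given the sequence tau of holding times. *)
Definition jump_time (R : realType) (Omega : Type)
    (tau : nat -> Omega -> \bar R) (n : nat) (w : Omega) : \bar R :=
  (\sum_(0 <= k < n) tau k w)%E.

(* Under each P x, Y is the discrete time chain with transition probabilities
   jump_prob started from x and, conditionally on Y, the holding times tau k
   are independent exponential variables with parameters jump_rate (Y k)
   (tau k = +oo almost surely if that parameter is 0). *)
Definition jump_chain_holding_times (R : realType) (V : choiceType)
    (mu : V -> V -> R) (nu : V -> R)
    (disp : measure_display) (Omega : measurableType disp)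
    (P : V -> probability Omega R)
    (Y : nat -> Omega -> V) (tau : nat -> Omega -> \bar R) : Prop :=
  [/\ forall n y, measurable [set w | Y n w = y],
      forall n, measurable_fun setT (tau n),
      forall n w, (0 < tau n w)%E
    & forall (x : V) (n : nat) (z : nat -> V) (s : nat -> R),
        (forall k, 0 <= s k) ->
        P x [set w | forall k, (k <= n)%N ->
                       Y k w = z k /\ ((s k)%:E < tau k w)%E] =
        ((z 0%N == x)%:R
         * (\prod_(k < n) jump_prob mu nu (z k) (z k.+1))
         * \prod_(k < n.+1) expR (- (jump_rate mu nu (z k) * s k)))%:E].

(* X t w = None means that the walk has been killed: t is not smaller than
   the explosion time, the supremum of the jump times. *)
Definition minimal_random_walk (R : realType) (V : choiceType)
    (mu : V -> V -> R) (nu : V -> R)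
    (disp : measure_display) (Omega : measurableType disp)
    (P : V -> probability Omega R) (X : R -> Omega -> option V) : Prop :=
  exists (Y : nat -> Omega -> V) (tau : nat -> Omega -> \bar R),
    jump_chain_holding_times mu nu P Y tau /\
    forall (t : R) (w : Omega) (y : V), 0 <= t ->
      (X t w = Some y <->
       exists n, (jump_time tau n w <= t%:E < jump_time tau n.+1 w)%E
                 /\ Y n w = y).

Definition is_distance (R : realType) (V : choiceType) (d : V -> V -> R) :
    Prop :=
  [/\ forall x y, 0 <= d x y,
      forall x y, d x y = 0 <-> x = y,
      forall x y, d x y = d y x
    & forall x y z, d x z <= d x y + d y z].

Definition adapted_distance (R : realType) (V : choiceType) (E : rel V)
    (mu : V -> V -> R) (nu : V -> R) (d : V -> V -> R) : Prop :=
  [/\ is_distance d,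
      forall x, (nu x)^-1 * \sum_(y \in [set: V]) (d x y ^+ 2 * mu x y) <= 1
    & forall x y, E x y -> d x y <= 1].

(* A function from [0, +oo[ to itself, positive on ]0, +oo[, is represented by
   a function on R whose values at negative arguments are irrelevant. *)
Definition nneg_pos_function (R : realType) (f : R -> R) : Prop :=
  0 <= f 0 /\ forall t, 0 < t -> 0 < f t.

(* When s = 0 and f 0 = 0 the comparison of ratios is cross-multiplied. *)
Definition regular_on (R : realType) (A gamma : R) (f : R -> R)
    (a : R) (b : \bar R) : Prop :=
  (forall s t, 0 <= s -> s <= t -> f s <= f t) /\
  forall s t, a <= s -> s < t -> (t%:E < (gamma^-1)%:E * b)%E ->
    if f s == 0 then f (gamma * s) * f t <= A * f (gamma * t) * f s
    else f (gamma * s) / f s <= A * (f (gamma * t) / f t).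

(* Main.v *)
Require Import Defs.
From HB Require Import structures.
From mathcomp Require Import all_boot all_order all_algebra.
From mathcomp Require Import finmap.
From mathcomp Require Import all_classical all_reals all_analysis.
From mathcomp Require Import measurable_realfun.
From mathcomp Require Import ring lra.

Set Implicit Arguments.
Unset Strict Implicit.
Unset Printing Implicit Defensive.
Import Order.TTheory GRing.Theory Num.Theory.
Import numFieldNormedType.Exports.

Local Open Scope classical_set_scope.
Local Open Scope ring_scope.

(** The proof is Grigor'yan's argument for heat kernels on manifolds: an upper
    bound at a vertex first gives a Gaussian bound for the mass of the squared
    heat kernel far from this vertex, and two such tails give the off-diagonal
    bound.

    Everything is proved for the walk killed on leaving a finite set of
    vertices, uniformly in that set, and a sequence of balls then exhausts the
    graph ([at_position_le]).  Killing decreases the transition probabilities,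
    so the assumed diagonal bounds survive.  From the law of jump chain and
    holding times one gets that the killed transition probabilities satisfy
    the forward equation ([killed_position_flow]); the key point is that the
    holding time after the n-th jump is exponential and independent of the
    first n jump times ([inside_tail]), which is a pi-lambda argument.  The
    forward equation is stated as a first-order expansion with an error
    C h^2, uniform in time, and is exploited by summing such expansions over
    a fine subdivision ([telescoping_le]); no derivative is ever taken.

    On the finite set the generator is symmetric in L^2(nu).  Hence the
    scalar product of u s and v (T - s) is constant for two solutions u and v
    ([heat_flow_duality]), which contains both the symmetry of the heat kernel
    and the Chapman-Kolmogorov equation.  Davies' method
    ([davies_gaffney]): for psi Lipschitz with constant lam for the adapted
    metric, the squared L^2 norm with weight exp (2 psi) grows at most like
    exp (4 lam^2 t).

    Let J r s be the mass of the squared kernel outside the ball of radius r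
    at time s, normalized to be 1 for r = s = 0.  Davies' method with
    psi = lam min(d, r) bounds J r s by J r' s' plus
    exp (- 2 lam (r - r')) / f (2 s'), up to a factor exp (4 lam^2 (s - s'))
    ([tail_mass_step]).  This is applied along the times t / (2 G^k), with
    G >= 2 a power of gamma, radii decreasing from d / 2 to d / 4 and
    geometrically growing lam.  The k-th term carries the factor
    exp (- c (9/8)^k d^2 / t), while by regularity 1 / f (t / G^(k+1)) is at
    most (A L)^k times 1 / f (t / G), with L = f t / f (t / G).  So the sum is
    of the order of its first term as soon as d^2 / t is large compared with
    log L ([gaussian_tail]); if it is not, the Gaussian factor costs less than
    replacing f t by f (t / G).  The chain stops when t / G^k reaches the size
    of T1 or d, where the growth bound on f is beaten by Davies' bound started
    at time 0; this is what the lower bound on t is for.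

    Finally p_t(x1, x2) is the scalar product of the two kernels at time t / 2.
    Every vertex is at distance at least d(x1, x2) / 2 from x1 or from x2, so
    by Cauchy-Schwarz each of the two parts of this scalar product is at most
    the square root of a tail times a diagonal term
    ([heat_kernel_offdiag]). *)

(** * Telescoping along small steps *)

Section Telescope.
Variable R : realType.

(** Over n equal steps of length h = (b - a) / n the increments of U telescope,
    so that the errors add up to C h (U b - U a), which vanishes with h.  With
    U the identity this replaces the fact that a function with nonpositive
    derivative decreases; with U a distribution function it controls a
    Stieltjes integral. *)
Lemma telescoping_le (N U : R -> R) (C h0 a b : R) : a <= b -> 0 < h0 ->
  (forall t h, a <= t -> 0 <= h -> h <= h0 -> t + h <= b ->
     N (t + h) - N t <= C * h * (U (t + h) - U t)) ->
  N b <= N a.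
Proof.
move=> ab h0_gt0 step.
rewrite leNgt; apply/negP => NaNb.
pose g := N b - N a.
have g_gt0 : 0 < g by rewrite subr_gt0.
pose B := C * (b - a) * (U b - U a).
have [n [nh nB]] : exists n : nat, (b - a) / n.+1%:R <= h0 /\ B / n.+1%:R < g.
  pose M := Num.max ((b - a) / h0) (B / g).
  have M0 : 0 <= M by rewrite le_max divr_ge0 ?subr_ge0 // ltW.
  exists (Num.trunc M).
  have MS : M < (Num.trunc M).+1%:R by apply: truncnS_gt.
  have S0 : (0 : R) < (Num.trunc M).+1%:R by rewrite ltr0n.
  split.
    rewrite ler_pdivrMr // mulrC -ler_pdivrMr //.
    by apply: le_trans (ltW MS); rewrite le_max lexx.
  rewrite ltr_pdivrMr // mulrC -ltr_pdivrMr //.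
  by apply: le_lt_trans MS; rewrite le_max lexx orbT.
pose h := (b - a) / n.+1%:R.
have n0 : (0 : R) < n.+1%:R by rewrite ltr0n.
have h_ge0 : 0 <= h by rewrite divr_ge0 ?subr_ge0 // ltW.
have tele k : (k <= n.+1)%N ->
    N (a + h * k%:R) - N a <= C * h * (U (a + h * k%:R) - U a).
  elim: k => [_|k IH kn]; first by rewrite mulr0 addr0 !subrr mulr0.
  have {}IH := IH (ltnW kn).
  have E : a + h * k.+1%:R = a + h * k%:R + h by rewrite -natr1 mulrDr mulr1 addrA.
  have := step (a + h * k%:R) h; rewrite -E => /(_ _ h_ge0 nh _).
  have -> : (a <= a + h * k%:R) by rewrite lerDl mulr_ge0 // ler0n.
  have -> : (a + h * k.+1%:R <= b).
    rewrite -lerBrDl /h mulrAC ler_pdivrMr // ler_wpM2l ?subr_ge0 //.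
    by rewrite ler_nat.
  by move=> /(_ isT isT); lra.
have := tele _ (leqnn _).
have -> : a + h * n.+1%:R = b by rewrite /h divfK ?gt_eqF // addrC subrK.
rewrite leNgt -/g => /negP; apply.
have -> : C * h * (U b - U a) = B / n.+1%:R by rewrite /B /h; ring.
exact: nB.
Qed.

Lemma telescoping_sqr_le (N : R -> R) (C h0 a b : R) : a <= b -> 0 < h0 ->
  (forall t h, a <= t -> 0 <= h -> h <= h0 -> t + h <= b ->
     N (t + h) <= N t + C * h ^+ 2) ->
  N b <= N a.
Proof.
move=> ab h0_gt0 step; apply: (@telescoping_le N id C h0) => // t h *.
have -> : C * h * (t + h - t) = C * h ^+ 2 by ring.
by rewrite lerBlDl; exact: step.
Qed.

Lemma telescoping_sqr_eq (N : R -> R) (C h0 a b : R) : a <= b -> 0 < h0 ->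
  (forall t h, a <= t -> 0 <= h -> h <= h0 -> t + h <= b ->
     `|N (t + h) - N t| <= C * h ^+ 2) ->
  N b = N a.
Proof.
move=> ab h0_gt0 step; apply/eqP; rewrite eq_le; apply/andP; split.
  apply: (@telescoping_sqr_le N C h0) => // t h at_ hh hh0 tb.
  by rewrite -lerBlDl; apply: le_trans (step _ _ at_ hh hh0 tb); exact: ler_norm.
rewrite -lerN2; apply: (@telescoping_sqr_le (fun t => - N t) C h0) => // t h at_ hh hh0 tb.
have := step _ _ at_ hh hh0 tb; rewrite ler_norml => /andP[]; lra.
Qed.

Lemma expR_le_quad (x : R) : x <= 1 / 2 -> expR x <= 1 + x + 2 * x ^+ 2.
Proof.
move=> x12.
have e1 := expR_ge1Dx (- x).
have x1 : 0 < 1 - x by lra.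
have : expR x <= (1 - x)^-1.
  by rewrite -[x in leLHS]opprK expRN lef_pV2 ?posrE ?expR_gt0 //.
move=> /le_trans; apply.
rewrite -div1r ler_pdivrMr //.
have -> : (1 + x + 2 * x ^+ 2) * (1 - x) = 1 + x ^+ 2 * (1 - 2 * x) by ring.
by rewrite lerDl mulr_ge0 ?sqr_ge0 //; lra.
Qed.

Lemma expR_cosh_le (x : R) : `|x| <= 1 / 2 ->
  expR x + expR (- x) - 2 <= 4 * x ^+ 2.
Proof.
rewrite ler_norml => /andP[? ?].
have := @expR_le_quad x; have := @expR_le_quad (- x); rewrite sqrrN.
move=> /(_ ltac:(lra)) ? /(_ ltac:(lra)) ?; lra.
Qed.

Lemma expRN_bounds (x : R) : 0 <= x -> 0 <= 1 - expR (- x) <= x.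
Proof.
move=> x0; rewrite subr_ge0 expR_le1 oppr_le0 x0 /=.
by have := expR_ge1Dx (- x); lra.
Qed.

Lemma expRN_quad (x : R) : 0 <= x -> `|1 - expR (- x) - x| <= 2 * x ^+ 2.
Proof.
move=> x0; have := expR_ge1Dx (- x) => H.
have := @expR_le_quad (- x); rewrite sqrrN => /(_ ltac:(lra)) H2.
rewrite ler_norml; apply/andP; split; lra.
Qed.

End Telescope.

(** * Heat flows on a finite weighted set *)

Section HeatFlow.
Variables (R : realType) (I : finType) (nu : I -> R) (m : I -> I -> R)
  (k : I -> R).
Hypothesis nu_gt0 : forall z, 0 < nu z.
Hypothesis m_sym : forall z w, m z w = m w z.
Hypothesis m_ge0 : forall z w, 0 <= m z w.
Hypothesis k_ge0 : forall z, 0 <= k z.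

Let nu_ge0 z : 0 <= nu z. Proof. exact: ltW. Qed.

(** In L^2(nu), the generator of the walk with edge weights m that is moreover
    killed at rate k z / nu z. *)
Definition heat_op (u : I -> R) (z : I) : R :=
  (nu z)^-1 * (\sum_w m z w * (u w - u z) - k z * u z).

(** The heat equation, as a first-order expansion uniform in time: only this is
    needed to telescope, and it survives pointwise limits. *)
Definition heat_flow (M : R) (u : R -> I -> R) : Prop :=
  (forall t i, 0 <= t -> 0 <= u t i <= M) /\
  exists C h0 : R, 0 < h0 /\ forall t h i, 0 <= t -> 0 <= h -> h <= h0 ->
    `|u (t + h) i - u t i - h * heat_op (u t) i| <= C * h ^+ 2.

Lemma heat_op_sym (u v : I -> R) :
  \sum_z nu z * (u z * heat_op v z) = \sum_z nu z * (v z * heat_op u z).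
Proof.
have E (f g : I -> R) : \sum_z nu z * (f z * heat_op g z) =
    \sum_z \sum_w m z w * (f z * g w) - \sum_z ((\sum_w m z w) + k z) * (f z * g z).
  rewrite -sumrB; apply: eq_bigr => z _; rewrite /heat_op.
  have -> : nu z * (f z * ((nu z)^-1 * (\sum_w m z w * (g w - g z) - k z * g z)))
    = f z * (\sum_w m z w * (g w - g z) - k z * g z).
    by field; rewrite gt_eqF.
  rewrite mulrBr mulr_sumr mulrDl opprD addrA mulr_suml -sumrB.
  congr (_ - _); last by ring.
  by apply: eq_bigr => w _; ring.
rewrite !E; congr (_ - _).
  rewrite exchange_big; apply: eq_bigr => z _; apply: eq_bigr => w _.
  by rewrite m_sym; ring.
by apply: eq_bigr => z _; ring.
Qed.

Lemma heat_op_bounded (M : R) : exists K, forall u : I -> R,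
  (forall i, 0 <= u i <= M) -> forall i, `|heat_op u i| <= K.
Proof.
pose Ki i := (nu i)^-1 * (\sum_w m i w * M + k i * M).
exists (\sum_i `|Ki i|) => u uM i.
apply: le_trans (_ : `|Ki i| <= _); last first.
  by rewrite (bigD1 i) //= lerDl sumr_ge0.
apply: le_trans (ler_norm _).
rewrite /heat_op /Ki normrM ger0_norm ?invr_ge0 ?nu_ge0 // ler_wpM2l ?invr_ge0 ?nu_ge0 //.
apply: le_trans (ler_normB _ _) _; rewrite lerD //.
  apply: le_trans (ler_norm_sum _ _ _) _; apply: ler_sum => w _.
  rewrite normrM ger0_norm // ler_wpM2l // ler_norml.
  by move: (uM i) (uM w) => /andP[? ?] /andP[? ?]; apply/andP; split; lra.
rewrite normrM ger0_norm // ler_wpM2l //.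
by move: (uM i) => /andP[? ?]; rewrite ger0_norm.
Qed.

Lemma heat_flow_taylor (M : R) (u : R -> I -> R) : heat_flow M u ->
  exists C h0 : R, [/\ 0 <= C, 0 < h0 & forall t h i, 0 <= t -> 0 <= h -> h <= h0 ->
    `|u (t + h) i - u t i - h * heat_op (u t) i| <= C * h ^+ 2 /\
    `|u (t + h) i - u t i| <= C * h].
Proof.
move=> [uM [C [h0 [h0_gt0 uC]]]].
have [K HK] := heat_op_bounded M.
exists (`|C| + `|K|), (Num.min h0 1); split.
- by rewrite addr_ge0.
- by rewrite lt_min h0_gt0 ltr01.
move=> t h i t0 hh; rewrite le_min => /andP[hh0 h1].
have H1 : `|u (t + h) i - u t i - h * heat_op (u t) i| <= `|C| * h ^+ 2.
  apply: le_trans (uC _ _ _ t0 hh hh0) _.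
  by rewrite ler_wpM2r ?sqr_ge0 // ler_norm.
split.
  by apply: le_trans H1 _; rewrite ler_wpM2r ?sqr_ge0 // lerDl.
have -> : u (t + h) i - u t i = (u (t + h) i - u t i - h * heat_op (u t) i)
  + h * heat_op (u t) i by ring.
apply: le_trans (ler_normD _ _) _; rewrite mulrDl lerD //.
  apply: le_trans H1 _; rewrite ler_wpM2l // expr2.
  by rewrite -[leRHS]mulr1 ler_wpM2l.
rewrite normrM ger0_norm // mulrC ler_wpM2r //.
by apply: le_trans (ler_norm _); apply: HK => j; exact: uM.
Qed.

(** The first-order terms of u (s + h) v (T - s - h) and u s v (T - s) differ by
    scalar products that symmetry of the generator makes equal, if both are
    expanded from the times s and T - s - h. *)
Lemma heat_flow_duality (M N : R) (u v : R -> I -> R) (T : R) :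
  heat_flow M u -> heat_flow N v -> 0 <= T ->
  forall s, 0 <= s -> s <= T ->
  \sum_z nu z * (u s z * v (T - s) z) = \sum_z nu z * (u 0 z * v T z).
Proof.
move=> Hu Hv T0 s s0 sT.
have [C [h0 [C0 h0_gt0 uC]]] := heat_flow_taylor Hu.
have [D [k0 [D0 k0_gt0 vD]]] := heat_flow_taylor Hv.
pose Phi s := \sum_z nu z * (u s z * v (T - s) z).
have -> : \sum_z nu z * (u 0 z * v T z) = Phi 0 by rewrite /Phi subr0.
rewrite -/(Phi s).
apply: (@telescoping_sqr_eq _ Phi (\sum_z nu z * (C * N + M * D))
  (Num.min h0 k0)) => //; first by rewrite lt_min h0_gt0.
move=> t h t0 hh; rewrite le_min => /andP[hh0 hk0] ths.
have r0 : 0 <= T - (t + h) by lra.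
set r := T - (t + h) in r0.
have E : T - t = r + h by rewrite /r; ring.
rewrite /Phi E -/r.
have -> : \sum_z nu z * (u (t + h) z * v r z) - \sum_z nu z * (u t z * v (r + h) z)
  = \sum_z nu z * ((u (t + h) z - u t z - h * heat_op (u t) z) * v r z
     - u t z * (v (r + h) z - v r z - h * heat_op (v r) z)).
  apply/eqP; rewrite -subr_eq0.
  have := heat_op_sym (u t) (v r) => /eqP; rewrite -subr_eq0 => /eqP S.
  rewrite -[X in _ == X](mulr0 (- h)) -[X in _ * X]S -!sumrB mulr_sumr.
  by apply/eqP; apply: eq_bigr => z _; ring.
apply: le_trans (ler_norm_sum _ _ _) _; rewrite mulr_suml; apply: ler_sum => z _.
rewrite normrM ger0_norm ?nu_ge0 // -mulrA ler_wpM2l ?nu_ge0 //.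
apply: le_trans (ler_normB _ _) _; rewrite !normrM.
have [uz _] := uC t h z t0 hh hh0; have [vz _] := vD r h z r0 hh hk0.
have /andP[u1 u2] := Hu.1 t z t0; have /andP[v1 v2] := Hv.1 r z r0.
have -> : (C * N + M * D) * h ^+ 2 = (C * h ^+ 2) * N + M * (D * h ^+ 2) by ring.
by rewrite lerD // ler_pM // ger0_norm.
Qed.

Variable d : I -> I -> R.
Hypothesis d_ge0 : forall z w, 0 <= d z w.
Hypothesis d_sym : forall z w, d z w = d w z.
Hypothesis d_le1 : forall z w, 0 < m z w -> d z w <= 1.
Hypothesis d_adapted : forall z, \sum_w m z w * d z w ^+ 2 <= nu z.

(** With e = exp psi, each edge contributes at most
    u z u w (e z - e w)^2, because
    (u w - u z) (u w (e w)^2 - u z (e z)^2)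
      = (u w e w - u z e z)^2 - u z u w (e w - e z)^2.
    The last square is e z e w (exp x + exp (- x) - 2) for x = psi z - psi w,
    at most 4 lam^2 d^2 e z e w, and adaptedness of the metric sums up the
    factors d^2. *)
Lemma heat_op_weighted_le (lam : R) (psi : I -> R) (u : I -> R) :
  0 <= lam -> lam <= 1 / 2 ->
  (forall z w, `|psi z - psi w| <= lam * d z w) ->
  (forall z, 0 <= u z) ->
  2 * (\sum_z nu z * (u z * heat_op u z * expR (2 * psi z))) <=
  4 * lam ^+ 2 * \sum_z nu z * (u z ^+ 2 * expR (2 * psi z)).
Proof.
move=> lam0 lam12 lip u0.
pose e z := expR (psi z).
have e0 z : 0 < e z by exact: expR_gt0.
have eE z : expR (2 * psi z) = e z ^+ 2 by rewrite mulrC expRM_natr.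
under eq_bigr do rewrite eE; under [in leRHS]eq_bigr do rewrite eE.
pose Q z w := m z w * (e z ^+ 2 * (u z * u w - u z ^+ 2)).
have S1 : \sum_z nu z * (u z * heat_op u z * e z ^+ 2) <= \sum_z \sum_w Q z w.
  apply: ler_sum => z _; rewrite /heat_op.
  have -> : nu z * (u z * ((nu z)^-1 * (\sum_w m z w * (u w - u z) - k z * u z)) * e z ^+ 2)
     = u z * e z ^+ 2 * \sum_w m z w * (u w - u z) - k z * u z ^+ 2 * e z ^+ 2.
    by field; rewrite gt_eqF.
  rewrite mulr_sumr (_ : \sum_w _ = \sum_w Q z w); last first.
    by apply: eq_bigr => w _; rewrite /Q; ring.
  by rewrite gerBl mulr_ge0 ?sqr_ge0 // mulr_ge0 ?sqr_ge0.
have S2 : \sum_z \sum_w Q z w = \sum_z \sum_w Q w z by rewrite exchange_big.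
apply: le_trans (_ : \sum_z \sum_w (Q z w + Q w z) <= _).
  rewrite mulrDl mul1r; apply: le_trans (lerD S1 S1) _.
  rewrite {2}S2 -big_split /= le_eqVlt; apply/orP; left; apply/eqP.
  by apply: eq_bigr => z _; rewrite -big_split.
pose a z := u z * e z.
pose W z w := m z w * d z w ^+ 2.
have S3 z w : Q z w + Q w z <= 2 * lam ^+ 2 * (W z w * a z ^+ 2 + W w z * a w ^+ 2).
  rewrite /Q /W (m_sym w z) (d_sym w z).
  rewrite -mulrDr.
  have -> : 2 * lam ^+ 2 * (m z w * d z w ^+ 2 * a z ^+ 2 +
      m z w * d z w ^+ 2 * a w ^+ 2) =
    m z w * (2 * lam ^+ 2 * d z w ^+ 2 * (a z ^+ 2 + a w ^+ 2)) by ring.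
  have [m0|m0] := eqVneq (m z w) 0; first by rewrite m0 !mul0r.
  have mpos : 0 < m z w by rewrite lt_neqAle eq_sym m0 m_ge0.
  rewrite ler_pM2l //.
  apply: le_trans (_ : u z * u w * (e z - e w) ^+ 2 <= _).
    have -> : e z ^+ 2 * (u z * u w - u z ^+ 2) + e w ^+ 2 * (u w * u z - u w ^+ 2)
     = u z * u w * (e z - e w) ^+ 2 - (u z * e z - u w * e w) ^+ 2 by ring.
    by rewrite gerBl sqr_ge0.
  have D1 := d_le1 mpos.
  have ld : `|psi z - psi w| <= 1 / 2.
    apply: le_trans (lip z w) _; apply: le_trans lam12.
    by rewrite -[leRHS]mulr1 ler_wpM2l.
  have -> : (e z - e w) ^+ 2 = e z * e w * (expR (psi z - psi w) + expR (- (psi z - psi w)) - 2).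
    have -> : expR (psi z - psi w) = e z / e w by rewrite expRD expRN.
    have -> : expR (- (psi z - psi w)) = e w / e z by rewrite opprB expRD expRN.
    by field; rewrite !gt_eqF.
  have C1 := expR_cosh_le ld.
  have C2 : (psi z - psi w) ^+ 2 <= lam ^+ 2 * d z w ^+ 2.
    by rewrite -exprMn -real_normK ?num_real // lerXn2r ?nnegrE ?mulr_ge0.
  have C3 : expR (psi z - psi w) + expR (- (psi z - psi w)) - 2 <= 4 * (lam ^+ 2 * d z w ^+ 2) by lra.
  have a0 : 0 <= a z * a w by rewrite !mulr_ge0 // ltW.
  have := ler_wpM2l a0 C3.
  have a2 : a z * a w <= (a z ^+ 2 + a w ^+ 2) / 2.
    by have := sqr_ge0 (a z - a w); rewrite sqrrB; lra.
  have l0 : 0 <= 4 * (lam ^+ 2 * d z w ^+ 2) by rewrite !mulr_ge0 ?sqr_ge0.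
  have := ler_wpM2r l0 a2; rewrite /a; lra.
apply: le_trans (ler_sum _ (fun z _ => ler_sum _ (fun w _ => S3 z w))) _.
have -> : \sum_z \sum_w 2 * lam ^+ 2 * (W z w * a z ^+ 2 + W w z * a w ^+ 2) =
   4 * lam ^+ 2 * \sum_z (\sum_w W z w) * a z ^+ 2.
  have X1 : \sum_z \sum_w W z w * a z ^+ 2 = \sum_z (\sum_w W z w) * a z ^+ 2.
    by apply: eq_bigr => z _; rewrite mulr_suml.
  under eq_bigr do rewrite -mulr_sumr; rewrite -mulr_sumr.
  under eq_bigr do rewrite big_split /=; rewrite big_split /=.
  have -> : \sum_z \sum_w W w z * a w ^+ 2 = \sum_z \sum_w W z w * a z ^+ 2.
    by rewrite exchange_big.
  by rewrite X1; ring.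
rewrite ler_wpM2l ?mulr_ge0 ?sqr_ge0 //; apply: ler_sum => z _.
have b0 : 0 <= u z ^+ 2 * e z ^+ 2 by rewrite mulr_ge0 ?sqr_ge0.
by rewrite /a exprMn; exact: ler_wpM2r b0 _ _ (d_adapted z).
Qed.

(** By [heat_op_weighted_le] the weighted norm E satisfies E' <= 4 lam^2 E. *)
Lemma davies_gaffney (M lam : R) (psi : I -> R) (u : R -> I -> R) (s t : R) :
  heat_flow M u -> 0 <= lam -> lam <= 1 / 2 ->
  (forall z w, `|psi z - psi w| <= lam * d z w) ->
  0 <= s -> s <= t ->
  \sum_z nu z * (u t z ^+ 2 * expR (2 * psi z)) <=
  expR (4 * lam ^+ 2 * (t - s)) * \sum_z nu z * (u s z ^+ 2 * expR (2 * psi z)).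
Proof.
move=> Hu lam0 lam12 lip s0 st.
have [C [h0 [C0 h0_gt0 uC]]] := heat_flow_taylor Hu.
pose a := 4 * lam ^+ 2.
have a0 : 0 <= a by rewrite mulr_ge0 ?sqr_ge0.
pose E t := \sum_z nu z * (u t z ^+ 2 * expR (2 * psi z)).
rewrite -/(E t) -/(E s) -/a.
suff : expR (- (a * (t - s))) * E t <= expR (- (a * (s - s))) * E s.
  rewrite subrr mulr0 oppr0 expR0 mul1r expRN.
  by rewrite ler_pdivrMl ?expR_gt0.
pose K := \sum_z nu z * ((2 * M * C + C ^+ 2) * expR (2 * psi z)).
apply: (@telescoping_sqr_le _ (fun t => expR (- (a * (t - s))) * E t) K h0) => //.
move=> r h sr hh hh0 rt.
have r0 : 0 <= r by apply: le_trans sr.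
have Estep : E (r + h) <= E r * (1 + a * h) + K * h ^+ 2.
  have W := @heat_op_weighted_le lam psi (u r) lam0 lam12 lip
    (fun z => proj1 (andP (Hu.1 r z r0))).
  rewrite -/(E r) -/a in W.
  apply: le_trans (_ : E r + h * (2 * \sum_z nu z * (u r z * heat_op (u r) z * expR (2 * psi z))) + K * h ^+ 2 <= _).
    rewrite /E /K mulr_sumr mulr_sumr -big_split mulr_suml -big_split /=.
    apply: ler_sum => z _.
    have -> : nu z * (u r z ^+ 2 * expR (2 * psi z)) +
      h * (2 * (nu z * (u r z * heat_op (u r) z * expR (2 * psi z)))) +
      nu z * ((2 * M * C + C ^+ 2) * expR (2 * psi z)) * h ^+ 2 =
      nu z * ((u r z ^+ 2 + 2 * h * u r z * heat_op (u r) z + (2 * M * C + C ^+ 2) * h ^+ 2) * expR (2 * psi z)) by ring.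
    rewrite ler_pM2l // ler_wpM2r ?expR_ge0 //.
    have [X1 X2] := uC r h z r0 hh hh0; have /andP[u1 u2] := Hu.1 r z r0.
    set v := u (r + h) z in X1 X2 *; set w := u r z in X1 X2 u1 u2 *.
    set L := heat_op _ _ in X1 *.
    have -> : v ^+ 2 = w ^+ 2 + 2 * h * w * L + 2 * w * (v - w - h * L) + (v - w) ^+ 2 by ring.
    have Y1 : (v - w) ^+ 2 <= C ^+ 2 * h ^+ 2.
      by rewrite -exprMn -[leLHS]real_normK ?num_real // lerXn2r ?nnegrE ?mulr_ge0.
    have Y2 : w * (v - w - h * L) <= M * (C * h ^+ 2).
      apply: le_trans (ler_norm _) _; rewrite normrM ler_pM //.
      by rewrite ger0_norm.
    lra.
  by have := ler_wpM2l hh W; lra.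
have e1 : expR (- (a * (r + h - s))) = expR (- (a * (r - s))) * expR (- (a * h)).
  by rewrite -expRD; congr expR; ring.
rewrite e1.
have K0 : 0 <= K.
  rewrite /K sumr_ge0 // => z _.
  have /andP[? ?] := Hu.1 r z r0; have M0 : 0 <= M by lra.
  by rewrite mulr_ge0 // mulr_ge0 ?expR_ge0 // addr_ge0 ?sqr_ge0 // !mulr_ge0.
have E0 : 0 <= E r.
  by rewrite sumr_ge0 // => z _; rewrite mulr_ge0 // mulr_ge0 ?expR_ge0 ?sqr_ge0.
have b1 : expR (- (a * h)) <= 1 by rewrite expR_le1 oppr_le0 mulr_ge0.
have b2 : expR (- (a * h)) * (1 + a * h) <= 1.
  by rewrite expRN ler_pdivrMl ?expR_gt0 // mulr1 expR_ge1Dx.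
have b3 : expR (- (a * (r - s))) <= 1 by rewrite expR_le1 oppr_le0 mulr_ge0 // subr_ge0.
have b4 : expR (- (a * h)) * E (r + h) <= E r + K * h ^+ 2.
  apply: le_trans (ler_wpM2l (expR_ge0 _) Estep) _.
  rewrite mulrDr lerD //.
    by rewrite mulrCA -[leRHS]mulr1 ler_wpM2l.
  by rewrite -[leRHS]mul1r ler_wpM2r ?mulr_ge0 ?sqr_ge0.
rewrite -mulrA; apply: le_trans (ler_wpM2l (expR_ge0 _) b4) _.
by rewrite mulrDr lerD // -[leRHS]mul1r ler_wpM2r ?mulr_ge0 ?sqr_ge0.
Qed.

(** * Heat kernels and their tails *)

Hypothesis d_refl : forall z, d z z = 0.
Hypothesis d_triangle : forall z w v, d z v <= d z w + d w v.

Definition heat_kernel (M : R) (a : I) (u : R -> I -> R) : Prop :=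
  heat_flow M u /\ forall z, u 0 z = (z == a)%:R / nu a.

(** The conserved scalar product, at the middle of the time interval and
    at its end. *)
Lemma heat_kernel_semigroup (M N : R) (a b : I) (u v : R -> I -> R) (t : R) :
  heat_kernel M a u -> heat_kernel N b v -> 0 <= t ->
  \sum_z nu z * (u (t / 2) z * v (t / 2) z) = u t b.
Proof.
move=> [Hu u0] [Hv v0] t0.
have E s := @heat_flow_duality M N u v t Hu Hv t0 s.
have t2 : t - t / 2 = t / 2 by field.
have tt : t <= t by [].
have := E (t / 2); rewrite t2 => -> ; try lra.
rewrite -(E t t0 tt) subrr (bigD1 b) //= big1 ?addr0.
  by rewrite v0 eqxx mul1r mulrCA divff ?mulr1 // gt_eqF.
by move=> z zb; rewrite v0 (negbTE zb) mul0r !mulr0.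
Qed.

(** The factor nu a normalizes the total mass at time 0 to 1, and turns the
    total mass at time s into a return probability at time 2 s. *)
Definition tail_mass (a : I) (u : R -> I -> R) (r s : R) : R :=
  nu a * \sum_(z | r <= d a z) nu z * u s z ^+ 2.

Lemma tail_mass_le (M : R) (a : I) (u : R -> I -> R) (r s : R) :
  heat_kernel M a u -> 0 <= s -> tail_mass a u r s <= nu a * u (2 * s) a.
Proof.
move=> Hu s0; rewrite -(heat_kernel_semigroup Hu Hu); last by rewrite mulr_ge0.
have -> : 2 * s / 2 = s by field.
rewrite /tail_mass ler_wpM2l // big_mkcond /=; apply: ler_sum => z _.
by rewrite -expr2; case: ifP => // _; rewrite mulr_ge0 ?sqr_ge0.
Qed.

(** The weight is 1 outside radius r and decreases like exp (2 lam (d - r))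
    inside. *)
Lemma tail_mass_weighted (M : R) (a : I) (u : R -> I -> R) (r s s' lam : R) :
  heat_kernel M a u -> 0 <= lam -> lam <= 1 / 2 -> 0 <= s' -> s' <= s ->
  tail_mass a u r s <= expR (4 * lam ^+ 2 * (s - s')) *
    (nu a * \sum_z nu z * (u s' z ^+ 2 * expR (2 * (lam * (Num.min (d a z) r - r))))).
Proof.
move=> [Hu _] lam0 lam12 s0 ss.
have lip z w : `|lam * (Num.min (d a z) r - r) - lam * (Num.min (d a w) r - r)|
    <= lam * d z w.
  rewrite -mulrBr normrM (ger0_norm lam0) ler_wpM2l //.
  have h1 := d_triangle a z w; have h2 := d_triangle a w z.
  have h3 := d_sym w z.
  rewrite ler_norml; apply/andP; split;
    by case: (leP (d a z) r) => ?; case: (leP (d a w) r) => ?; lra.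
have := davies_gaffney Hu lam0 lam12 lip s0 ss => /(ler_wpM2l (nu_ge0 a)) H.
rewrite [leRHS]mulrCA; apply: le_trans H.
rewrite /tail_mass ler_wpM2l // big_mkcond /=; apply: ler_sum => z _.
case: ifP => rd; last first.
  by rewrite mulr_ge0 // mulr_ge0 ?sqr_ge0 ?expR_ge0.
by rewrite min_r // subrr !mulr0 expR0 mulr1.
Qed.

(** At time s' the weight is at most 1 outside radius r', and at most
    exp (- 2 lam (r - r')) inside. *)
Lemma tail_mass_step (M : R) (a : I) (u : R -> I -> R) (r r' s s' lam : R) :
  heat_kernel M a u -> 0 <= lam -> lam <= 1 / 2 -> r' <= r -> 0 <= s' -> s' <= s ->
  tail_mass a u r s <= expR (4 * lam ^+ 2 * (s - s')) *
    (tail_mass a u r' s' + expR (- (2 * lam * (r - r'))) * (nu a * u (2 * s') a)).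
Proof.
move=> Hu lam0 lam12 rr s0 ss.
apply: le_trans (tail_mass_weighted r Hu lam0 lam12 s0 ss) _.
rewrite ler_wpM2l ?expR_ge0 //.
rewrite -(heat_kernel_semigroup Hu Hu); last by rewrite mulr_ge0.
have -> : 2 * s' / 2 = s' by field.
rewrite /tail_mass mulrCA -mulrDr ler_wpM2l //.
rewrite [X in _ <= X + _]big_mkcond mulr_sumr -big_split /=.
apply: ler_sum => z _.
have U0 : 0 <= nu z * u s' z ^+ 2 by rewrite mulr_ge0 ?sqr_ge0.
rewrite mulrA -expr2.
have [rd|rd] := leP r' (d a z).
  apply: le_trans (_ : nu z * u s' z ^+ 2 <= _).
    rewrite -[leRHS]mulr1 ler_wpM2l // expR_le1 mulr_ge0_le0 // mulr_ge0_le0 //.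
    by rewrite subr_le0 ge_min lexx orbT.
  by rewrite lerDl mulr_ge0 ?expR_ge0.
rewrite add0r mulrC ler_wpM2r // ler_expR.
rewrite min_l; last by apply: le_trans rr; exact: ltW.
have : lam * (d a z) <= lam * r' by rewrite ler_wpM2l // ltW.
lra.
Qed.

(** At time 0 all the mass sits at a, where the weight is at most
    exp (- 2 lam r). *)
Lemma tail_mass_davies (M : R) (a : I) (u : R -> I -> R) (r s lam : R) :
  heat_kernel M a u -> 0 <= lam -> lam <= 1 / 2 -> 0 <= s ->
  tail_mass a u r s <= expR (4 * lam ^+ 2 * s - 2 * lam * r).
Proof.
move=> Hu lam0 lam12 s0.
apply: le_trans (tail_mass_weighted r Hu lam0 lam12 (lexx 0) s0) _.
rewrite subr0 expRD ler_wpM2l ?expR_ge0 //.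
rewrite (bigD1 a) //= big1 ?addr0; last first.
  by move=> z za; rewrite Hu.2 (negbTE za) mul0r expr0n /= mul0r mulr0.
rewrite Hu.2 eqxx mul1r d_refl.
have -> : nu a * (nu a * ((nu a)^-1 ^+ 2 * expR (2 * (lam * (Num.min 0 r - r))))) =
  expR (2 * (lam * (Num.min 0 r - r))) by field; rewrite gt_eqF.
rewrite ler_expR.
have h : lam * Num.min 0 r <= 0 by rewrite mulr_ge0_le0 // ge_min lexx.
lra.
Qed.

(** Cauchy-Schwarz, with the bounds p and q of the norms given as data. *)
Lemma sum_mul_le (S : pred I) (u v : I -> R) (p q : R) : 0 < p -> 0 < q ->
  \sum_(z | S z) nu z * u z ^+ 2 <= p ^+ 2 ->
  \sum_(z | S z) nu z * v z ^+ 2 <= q ^+ 2 ->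
  \sum_(z | S z) nu z * (u z * v z) <= p * q.
Proof.
move=> p0 q0 Hu Hv.
apply: le_trans (_ : q / p / 2 * (\sum_(z | S z) nu z * u z ^+ 2) +
    p / q / 2 * (\sum_(z | S z) nu z * v z ^+ 2) <= _).
  rewrite !mulr_sumr -big_split /=; apply: ler_sum => z _.
  rewrite -subr_ge0.
  have -> : q / p / 2 * (nu z * u z ^+ 2) + p / q / 2 * (nu z * v z ^+ 2) -
      nu z * (u z * v z) = nu z * (q * u z - p * v z) ^+ 2 / (2 * p * q).
    by field; rewrite !gt_eqF.
  have pq0 : 0 <= 2 * p * q by rewrite ltW // !mulr_gt0.
  by rewrite divr_ge0 // mulr_ge0 ?sqr_ge0.
have -> : p * q = q / p / 2 * p ^+ 2 + p / q / 2 * q ^+ 2 by field; rewrite !gt_eqF.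
by apply: lerD; apply: ler_wpM2l => //; rewrite ltW // !divr_gt0.
Qed.

(** Each z is at distance at least d a b / 2 from a or from b. *)
Lemma heat_kernel_offdiag (M N : R) (a b : I) (u v : R -> I -> R)
    (t pa qa pb qb : R) :
  heat_kernel M a u -> heat_kernel N b v -> 0 <= t ->
  0 < pa -> 0 < qa -> 0 < pb -> 0 < qb ->
  tail_mass a u (d a b / 2) (t / 2) <= nu a * pa ^+ 2 ->
  tail_mass b v (d a b / 2) (t / 2) <= nu b * pb ^+ 2 ->
  u t a <= qa ^+ 2 -> v t b <= qb ^+ 2 ->
  u t b <= pa * qb + qa * pb.
Proof.
move=> Hu Hv t0 pa0 qa0 pb0 qb0 Ha Hb Da Db.
rewrite -(heat_kernel_semigroup Hu Hv t0).
rewrite -(heat_kernel_semigroup Hu Hu t0) in Da.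
rewrite -(heat_kernel_semigroup Hv Hv t0) in Db.
set s := t / 2 in Ha Hb Da Db *; set r := d a b / 2 in Ha Hb.
have s0 : 0 <= s by rewrite divr_ge0.
have Hsub (f : I -> R) (S : pred I) : (forall z, 0 <= f z) ->
    \sum_(z | S z) f z <= \sum_z f z.
  by move=> f0; rewrite [leLHS]big_mkcond; apply: ler_sum => z _; case: ifP.
have u0 z : 0 <= u s z by have /andP[] := Hu.1.1 s z s0.
have v0 z : 0 <= v s z by have /andP[] := Hv.1.1 s z s0.
have D2 (w : I -> R) (c : R) (S : pred I) : \sum_z nu z * (w z * w z) <= c ->
    \sum_(z | S z) nu z * w z ^+ 2 <= c.
  move=> h; apply: le_trans h; apply: Hsub => z; by rewrite mulr_ge0 ?sqr_ge0.
move: Ha Hb; rewrite /tail_mass !ler_pM2l // => Ha Hb.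
have Sa := sum_mul_le pa0 qb0 Ha (D2 _ _ _ Db).
have Sb := sum_mul_le qa0 pb0 (D2 _ _ _ Da) Hb.
apply: le_trans (lerD Sa Sb).
rewrite [X in _ <= X + _]big_mkcond [X in _ <= _ + X]big_mkcond -big_split /=.
apply: ler_sum => z _.
have uv0 : 0 <= nu z * (u s z * v s z) by rewrite !mulr_ge0.
case: ifP => ra; first by rewrite lerDl; case: ifP.
case: ifP => rb; first by rewrite add0r.
have := d_triangle a z b; rewrite (d_sym z b).
move: ra rb => /negbT; rewrite -ltNge => ra /negbT; rewrite -ltNge => rb.
by move: ra rb; rewrite /r; lra.
Qed.

End HeatFlow.

(** * Probabilities as real numbers *)

Section PiLambda.
Context (R : realType) (disp : measure_display) (Omega : measurableType disp).
Variable Q : probability Omega R.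

(** Both sides are finite measures in X. *)
Lemma measure_eq_on_generated (G : set (set Omega)) (A A' : set Omega) (c : R) :
  setI_closed G -> G setT -> G `<=` measurable ->
  measurable A -> measurable A' -> 0 <= c ->
  (forall X, G X -> Q (X `&` A) = (c%:E * Q (X `&` A'))%E) ->
  forall X, <<s G >> X -> Q (X `&` A) = (c%:E * Q (X `&` A'))%E.
Proof.
move=> GI GT Gm mA mA' c0 QG X sX.
pose m1 := mrestr Q mA.
pose m2 := mscale (NngNum c0) (mrestr Q mA').
have GE : [set X | G X /\ X `<=` setT] = G.
  by apply/seteqP; split => [Z []//|Z GZ]; split.
have := @g_sigma_algebra_measure_unique_trace _ R Omega G setT measurableT.
rewrite GE => /(_ Gm GI m1 m2).
have m12 Z : G Z -> m1 Z = m2 Z.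
  by move=> /QG E; rewrite /m1 /m2 /mscale /mrestr /= E.
move=> /(_ (m12 _ GT) m12).
have fin : (m1 setT < +oo)%E.
  rewrite /m1 /mrestr /= setTI; apply: le_lt_trans (ltry 1).
  exact: probability_le1.
by move=> /(_ fin (fun _ _ _ _ => I)) /(_ _ sX).
Qed.

End PiLambda.

Section RealProbability.
Context (R : realType) (disp : measure_display) (Omega : measurableType disp).
Variable Q : probability Omega R.

Definition pr (A : set Omega) : R := fine (Q A).

Lemma prE (A : set Omega) : measurable A -> Q A = (pr A)%:E.
Proof. by move=> mA; rewrite /pr fineK // fin_num_measure. Qed.

Lemma pr_ge0 (A : set Omega) : 0 <= pr A.
Proof. by rewrite /pr fine_ge0. Qed.

Lemma pr_le1 (A : set Omega) : measurable A -> pr A <= 1.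
Proof. by move=> mA; rewrite -lee_fin -prE // probability_le1. Qed.

Lemma pr0 : pr set0 = 0.
Proof. by rewrite /pr measure0. Qed.

Lemma pr_le (A B : set Omega) : measurable A -> measurable B -> A `<=` B ->
  pr A <= pr B.
Proof. by move=> mA mB AB; rewrite -lee_fin -!prE // le_measure ?inE. Qed.

Lemma prDI (A B : set Omega) : measurable A -> measurable B ->
  pr A = pr (A `&` B) + pr (A `&` ~` B).
Proof.
move=> mA mB; have mC := measurableC mB; apply: EFin_inj.
rewrite EFinD -!prE //; try exact: measurableI.
by rewrite addeC -setDE -measureDI.
Qed.

Lemma pr_partition (J : finType) (A : set Omega) (F : J -> set Omega) :
  measurable A -> (forall j, measurable (F j)) ->
  (forall i j w, F i w -> F j w -> i = j) ->
  (forall w, A w -> exists j, F j w) ->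
  pr A = \sum_j pr (A `&` F j).
Proof.
move=> mA mF Fdis Fcov.
suff H (s : seq J) : uniq s -> forall B, measurable B ->
    (forall w, B w -> exists2 j, j \in s & F j w) ->
    pr B = \sum_(j <- s) pr (B `&` F j).
  rewrite -big_enum /=; apply: H => //; first exact: enum_uniq.
  by move=> w /Fcov[j Fj]; exists j => //; rewrite mem_enum.
elim: s => [_ B mB Bs|j s IH /= /andP[js us] B mB Bs].
  rewrite big_nil; suff -> : B = set0 by exact: pr0.
  by apply/seteqP; split => // w /Bs[].
have mC := measurableC (mF j).
rewrite big_cons (prDI mB (mF j)); congr (_ + _).
rewrite (IH us); first last.
- move=> w [/Bs[i]]; rewrite in_cons => /orP[/eqP -> //|si Fi _].
  by exists i.
- exact: measurableI.
apply: eq_big_seq => i si; congr pr; apply/seteqP; split=> w; first by case=> [[]].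
move=> [Bw Fi]; split => //; split => // Fj.
by move: js; rewrite (Fdis _ _ _ Fj Fi) si.
Qed.

End RealProbability.

(** * Holding times and jump times *)

Section HoldingTimes.
Context (R : realType) (disp : measure_display) (Omega : measurableType disp).
Variable tau : nat -> Omega -> \bar R.
Hypothesis tau_meas : forall k, measurable_fun setT (tau k).
Hypothesis tau_gt0 : forall k w, (0 < tau k w)%E.

(** Events on the first n holding times whose probability is given by the
    law of the chain; they form a pi-system. *)
Definition tail_rect (n : nat) (s : nat -> R) : set Omega :=
  [set w | forall k, (k < n)%N -> ((s k)%:E < tau k w)%E].

Definition tail_rects (n : nat) : set (set Omega) :=
  [set tail_rect n s | s in [set s : nat -> R | forall k, 0 <= s k]].

Lemma measurable_tau_gt (k : nat) (s : R) :
  measurable [set w | (s%:E < tau k w)%E].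
Proof.
rewrite -[X in measurable X]setTI.
exact: (emeasurable_fun_o_infty measurableT (tau_meas k)).
Qed.

Lemma measurable_tail_rect n s : measurable (tail_rect n s).
Proof.
rewrite (_ : tail_rect n s = \bigcap_(k in [set k | (k < n)%N])
   [set w | ((s k)%:E < tau k w)%E]); last by apply/seteqP; split.
by apply: bigcap_measurableType => k _; exact: measurable_tau_gt.
Qed.

Lemma tail_rects_setI n : setI_closed (tail_rects n).
Proof.
move=> _ _ [s s0 <-] [s' s'0 <-]; exists (fun k => Num.max (s k) (s' k)).
  by move=> k /=; rewrite le_max s0.
apply/seteqP; split => w.
  move=> H; split => k kn; have := H _ kn; apply: le_lt_trans;
  by rewrite lee_fin le_max lexx ?orbT.
move=> [H1 H2] k kn; have := H1 _ kn; have := H2 _ kn.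
move=> h1 h2; rewrite /Num.max; by case: ifP.
Qed.

Lemma tail_rects_setT n : tail_rects n setT.
Proof.
by exists (fun=> 0) => //; apply/seteqP; split => // w _ k _; exact: tau_gt0.
Qed.

Lemma tail_rects_measurable n : tail_rects n `<=` measurable.
Proof. by move=> _ [s _ <-]; exact: measurable_tail_rect. Qed.

(** Needed to apply to jump times what is known on the pi-system: the n-th jump
    time is a sum of holding times of index less than n. *)
Lemma jump_time_generated n (t : R) :
  <<s tail_rects n >> [set w | (jump_time tau n w <= t%:E)%E].
Proof.
pose T := g_sigma_algebraType (tail_rects n).
have mtau k : (k < n)%N -> measurable_fun (setT : set T) (tau k).
  move=> kn; apply: (measurability _ (ErealGenOInfty.measurableE R)) => //.
  move=> _ [_ [r ->] <-]; rewrite setTI.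
  have [r0|r0] := leP 0 r; last first.
    rewrite (_ : _ @^-1` _ = setT); first exact: measurableT.
    apply/seteqP; split => // w _ /=; rewrite in_itv /= andbT.
    by apply: lt_trans (tau_gt0 k w); rewrite lte_fin.
  apply: sub_sigma_algebra; exists (fun j => if j == k then r else 0).
    by move=> j /=; case: ifP.
  apply/seteqP; split => w /=.
    by move=> /(_ _ kn); rewrite eqxx in_itv /= andbT.
  rewrite in_itv /= andbT => rk j jn; case: eqP => [-> //|_]; exact: tau_gt0.
have mS : measurable_fun (setT : set T) (jump_time tau n).
  rewrite /jump_time; under eq_fun do rewrite big_mkord.
  by apply: emeasurable_sum => i; exact: mtau.
have := emeasurable_fun_infty_c measurableT mS t%:E.
by rewrite setTI.
Qed.

Lemma generated_measurable n X : <<s tail_rects n >> X -> measurable X.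
Proof.
apply: smallest_sub; last exact: tail_rects_measurable.
split; first exact: measurable0.
- by move=> A mA; rewrite setTD; exact: measurableC.
- by move=> F mF; exact: bigcupT_measurable.
Qed.

Lemma measurable_jump_time n (t : R) :
  measurable [set w | (jump_time tau n w <= t%:E)%E].
Proof. by apply: (@generated_measurable n); exact: jump_time_generated. Qed.

Lemma jump_time_ge0 n w : (0 <= jump_time tau n w)%E.
Proof. by apply: sume_ge0 => k _; exact: ltW. Qed.

Lemma jump_timeS n w : jump_time tau n.+1 w = (jump_time tau n w + tau n w)%E.
Proof. by rewrite /jump_time big_nat_recr. Qed.

Lemma jump_time_le m n w : (m <= n)%N ->
  (jump_time tau m w <= jump_time tau n w)%E.
Proof.
move=> mn; rewrite -(subnK mn); elim: (n - m)%N => [//|k IH].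
apply: le_trans IH _; rewrite addSn jump_timeS leeDl // ltW //.
Qed.

End HoldingTimes.

(** * The chain inside a finite set of states *)

Section ChainLaw.
Context (R : realType) (disp : measure_display) (Omega : measurableType disp).
Variables (V : choiceType) (Q : probability Omega R).
Variables (Y : nat -> Omega -> V) (tau : nat -> Omega -> \bar R).
Variables (x : V) (q : V -> R) (jp : V -> V -> R).
Hypothesis Y_meas : forall n y, measurable [set w | Y n w = y].
Hypothesis tau_meas : forall k, measurable_fun setT (tau k).
Hypothesis tau_gt0 : forall k w, (0 < tau k w)%E.
Hypothesis jp_ge0 : forall v w, 0 <= jp v w.
Hypothesis law : forall (n : nat) (z : nat -> V) (s : nat -> R),
  (forall k, 0 <= s k) ->
  Q [set w | forall k, (k <= n)%N -> Y k w = z k /\ ((s k)%:E < tau k w)%E] =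
  ((z 0%N == x)%:R * (\prod_(k < n) jp (z k) (z k.+1))
   * \prod_(k < n.+1) expR (- (q (z k) * s k)))%:E.

Let cyl n (z : nat -> V) := [set w | forall k, (k <= n)%N -> Y k w = z k].
Let gt n (s : R) := [set w | (s%:E < tau n w)%E].

Let mgt n s : measurable (gt n s).
Proof. exact: measurable_tau_gt. Qed.

Let mcyl n z : measurable (cyl n z).
Proof.
rewrite (_ : cyl n z = \bigcap_(k in [set k | (k <= n)%N]) [set w | Y k w = z k]).
  by apply: bigcap_measurableType => k _; exact: Y_meas.
by apply/seteqP; split.
Qed.

Let rect_cyl n z (s : nat -> R) :
  tail_rect tau n.+1 s `&` cyl n z =
  [set w | forall k, (k <= n)%N -> Y k w = z k /\ ((s k)%:E < tau k w)%E].
Proof.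
apply/seteqP; split => w /=.
  by move=> [H1 H2] k kn; split; [exact: H2|exact: H1].
by move=> H; split => k kn; have [] := H k kn.
Qed.

Let rect_gt n (s : nat -> R) (r : R) :
  tail_rect tau n.+1 (fun k => if k == n then r else s k) =
  tail_rect tau n s `&` gt n r.
Proof.
apply/seteqP; split => w.
  move=> H; split.
    by move=> k kn; have := H k (ltnW kn); rewrite ltn_eqF.
  by have := H n (ltnSn n); rewrite eqxx.
move=> [H1 H2] k; rewrite ltnS leq_eqVlt; case: eqP => [-> _|_] //=.
exact: H1.
Qed.

(** On the pi-system, both sides are given by the law of the chain, with the
    last holding time constrained to exceed s or 0. *)
Let cyl_tail n z (s : R) (X : set Omega) : 0 <= s -> <<s tail_rects tau n >> X ->
  Q (X `&` (cyl n z `&` gt n s)) =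
  ((expR (- (q (z n) * s)))%:E * Q (X `&` cyl n z))%E.
Proof.
move=> s0; apply: measure_eq_on_generated.
- exact: tail_rects_setI.
- exact: tail_rects_setT.
- exact: tail_rects_measurable.
- exact: measurableI.
- exact: mcyl.
- exact: expR_ge0.
move=> _ [r r0 <-].
have E (s' : R) : 0 <= s' ->
  Q (tail_rect tau n r `&` (cyl n z `&` gt n s')) =
  ((z 0%N == x)%:R * (\prod_(k < n) jp (z k) (z k.+1)) *
   (\prod_(k < n) expR (- (q (z k) * r k)) * expR (- (q (z n) * s'))))%:E.
  move=> s'0; rewrite (setIC (cyl n z)) setIA -rect_gt rect_cyl law; last first.
    by move=> k; case: ifP.
  rewrite big_ord_recr /= eqxx; congr (_ * (_ * _))%:E.
  by apply: eq_bigr => k _; rewrite ltn_eqF.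
rewrite E //.
have -> : tail_rect tau n r `&` cyl n z = tail_rect tau n r `&` (cyl n z `&` gt n 0).
  congr (_ `&` _); apply/seteqP; split => w; last by case.
  by move=> H; split => //; exact: tau_gt0.
by rewrite E // mulr0 oppr0 expR0 mulr1 -EFinM; congr EFin; ring.
Qed.

(** Leaving the holding time of index n + 1 free amounts to taking s (n + 1) = 0,
    since it is positive. *)
Let cyl_step n z (X : set Omega) : <<s tail_rects tau n.+1 >> X ->
  Q (X `&` cyl n.+1 z) = ((jp (z n) (z n.+1))%:E * Q (X `&` cyl n z))%E.
Proof.
apply: measure_eq_on_generated.
- exact: tail_rects_setI.
- exact: tail_rects_setT.
- exact: tail_rects_measurable.
- exact: mcyl.
- exact: mcyl.
- exact: jp_ge0.
move=> _ [r r0 <-].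
rewrite rect_cyl law //.
have -> : tail_rect tau n.+1 r `&` cyl n.+1 z =
    (tail_rect tau n.+1 r `&` gt n.+1 0) `&` cyl n.+1 z.
  apply/seteqP; split => w [H1 H2]; last by split=> //; case: H1.
  by do 2!split => //; exact: tau_gt0.
rewrite -rect_gt rect_cyl law; last by move=> k; case: ifP.
rewrite big_ord_recr /= [in X in _ * X]big_ord_recr /= eqxx mulr0 oppr0 expR0 mulr1.
rewrite -EFinM; congr EFin.
rewrite (eq_bigr (fun k : 'I_n.+1 => expR (- (q (z k) * r k)))); first by ring.
by move=> k _; rewrite ltn_eqF.
Qed.

Variables (I : finType) (iota : I -> V).
Hypothesis iota_inj : injective iota.

Definition inside (n : nat) (i : I) : set Omega :=
  [set w | (forall k, (k <= n)%N -> exists j, Y k w = iota j) /\ Y n w = iota i].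

Lemma measurable_inside n i : measurable (inside n i).
Proof.
rewrite (_ : inside n i = \bigcap_(k in [set k | (k <= n)%N])
   (\bigcup_(j in [set: I]) [set w | Y k w = iota j]) `&` [set w | Y n w = iota i]).
  apply: measurableI; last exact: Y_meas.
  apply: bigcap_measurableType => k _; apply: fin_bigcup_measurable.
    exact: finite_finset.
  by move=> j _; exact: Y_meas.
apply/seteqP; split=> w [H ?]; split => // k kn.
  by have [j] := H k kn; exists j.
by have [j _] := H k kn; exists j.
Qed.

(** A path with n jumps in I, extended to all times by repeating some vertex. *)
Let ext n (c : {ffun 'I_n.+1 -> I}) (k : nat) : V := iota (c (inord k)).

Let inside_paths n i (X : set Omega) : measurable X ->
  pr Q (X `&` inside n i) =
  \sum_(c : {ffun 'I_n.+1 -> I} | c ord_max == i) pr Q (X `&` cyl n (ext c)).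
Proof.
move=> mX.
rewrite (@pr_partition _ _ _ Q {ffun 'I_n.+1 -> I} _ (fun c => cyl n (ext c))); first last.
- move=> w [_ [Hw _]].
  have [g gE] := choice (fun k : 'I_n.+1 => Hw k (leq_ord k)).
  exists [ffun k => g k] => k kn; rewrite /ext ffunE -gE /=.
  by rewrite inordK.
- move=> c c' w Hc Hc'; apply/ffunP => k; apply: iota_inj.
  have := Hc k (leq_ord k); have := Hc' k (leq_ord k).
  by rewrite /ext inord_val => -> ->.
- by move=> c; exact: mcyl.
- by apply: measurableI => //; exact: measurable_inside.
have om (c : {ffun 'I_n.+1 -> I}) : ext c n = iota (c ord_max).
  by rewrite /ext; congr (iota (c _)); apply: val_inj; rewrite /= inordK.
rewrite [RHS]big_mkcond /=; apply: eq_bigr => c _; case: eqP => ci.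
  congr pr; apply/seteqP; split => w; first by case=> [[]].
  move=> [Xw Hw]; split => //; split => //; split.
    by move=> k kn; exists (c (inord k)); exact: Hw.
  by rewrite -ci -om; exact: Hw.
rewrite (_ : _ `&` _ = set0) ?pr0 //; apply/seteqP; split => // w [[_ [_ Hw]] Hc].
by apply: ci; apply: iota_inj; rewrite -om -Hw; apply/esym/Hc.
Qed.

(** The holding time of index n is exponential, independently of the earlier
    ones and of the path: sum [cyl_tail] over the finitely many paths. *)
Lemma inside_tail n i (s : R) (X : set Omega) : 0 <= s ->
  <<s tail_rects tau n >> X ->
  pr Q (X `&` inside n i `&` [set w | (s%:E < tau n w)%E]) =
  expR (- (q (iota i) * s)) * pr Q (X `&` inside n i).
Proof.
move=> s0 sX; have mX := generated_measurable tau_meas sX.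
rewrite setIAC !inside_paths //; last by apply: measurableI => //; exact: mgt.
rewrite mulr_sumr; apply: eq_bigr => c /eqP ci.
rewrite setIAC -setIA /pr cyl_tail //.
have -> : ext c n = iota i.
  by rewrite /ext -ci; congr (iota (c _)); apply: val_inj; rewrite /= inordK.
by rewrite fineM // ?fin_num_measure //; exact: measurableI.
Qed.

Lemma inside_step n i j (X : set Omega) : <<s tail_rects tau n.+1 >> X ->
  pr Q (X `&` inside n i `&` [set w | Y n.+1 w = iota j]) =
  jp (iota i) (iota j) * pr Q (X `&` inside n i).
Proof.
move=> sX; have mX := generated_measurable tau_meas sX.
rewrite setIAC !inside_paths //; last by apply: measurableI => //; exact: Y_meas.
rewrite mulr_sumr; apply: eq_bigr => c /eqP ci.
pose z k := if k == n.+1 then iota j else ext c k.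
have zE k : (k <= n)%N -> z k = ext c k by move=> kn; rewrite /z ltn_eqF // ltnS.
have -> : cyl n (ext c) = cyl n z.
  by apply/seteqP; split => w H k kn; rewrite H // zE.
have -> : X `&` [set w | Y n.+1 w = iota j] `&` cyl n z = X `&` cyl n.+1 z.
  apply/seteqP; split => w.
    move=> [[Xw Hj] Hc]; split => // k; rewrite leq_eqVlt => /orP[/eqP ->|kn].
      by rewrite /z eqxx.
    exact: Hc.
  move=> [Xw Hc]; split; last by move=> k kn; apply: Hc; exact: ltnW.
  by split => //; have := Hc n.+1 (leqnn _); rewrite /z eqxx.
rewrite /pr cyl_step //.
have -> : z n = iota i.
  rewrite zE // /ext -ci; congr (iota (c _)); apply: val_inj; rewrite /= inordK //.
have -> : z n.+1 = iota j by rewrite /z eqxx.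
by rewrite fineM // ?fin_num_measure //; exact: measurableI.
Qed.

(** * The forward equation of the killed walk *)

Hypothesis q_ge0 : forall v, 0 <= q v.

Let S n := jump_time tau n.
Let upto n (t : R) := [set w | (S n w <= t%:E)%E].
Let win n (a b : R) := upto n b `&` ~` upto n a.

Let mupto n t : measurable (upto n t).
Proof. exact: measurable_jump_time. Qed.

Let mwin n a b : measurable (win n a b).
Proof. by apply: measurableI => //; apply: measurableC. Qed.

Let upto_gen n t : <<s tail_rects tau n >> (upto n t).
Proof. exact: jump_time_generated. Qed.

Let win_gen n a b : <<s tail_rects tau n >> (win n a b).
Proof.
have := @measurableD _ (g_sigma_algebraType (tail_rects tau n)) (upto n b) (upto n a).
by rewrite setDE; apply; exact: upto_gen.
Qed.

Let minside n i : measurable (inside n i).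
Proof. exact: measurable_inside. Qed.

(** If the n-th jump occurs at a time between a and b, then the next one occurs
    after T if the holding time exceeds T - a, and only if it
    exceeds T - b. *)
Let window_bounds n i (a b T : R) : a <= b -> b <= T ->
  expR (- (q (iota i) * (T - a))) * pr Q (win n a b `&` inside n i) <=
  pr Q (win n a b `&` inside n i `&` ~` upto n.+1 T) <=
  expR (- (q (iota i) * (T - b))) * pr Q (win n a b `&` inside n i).
Proof.
move=> ab bT; have mC := measurableC (mupto n.+1 T).
have mWI : measurable (win n a b `&` inside n i) by exact: measurableI.
have sE w : (S n.+1 w = S n w + tau n w)%E by exact: jump_timeS.
have Ta : 0 <= T - a by lra.
have Tb : 0 <= T - b by lra.
have tl s (s0 : 0 <= s) := @inside_tail n i s _ s0 (@win_gen n a b).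
rewrite -!tl //.
apply/andP; split; last first.
- apply: pr_le.
  + exact: measurableI.
  + by apply: measurableI => //; exact: mgt.
  move=> w [[[/= Sb Sa] Iw] ST]; split; first by split.
  move: ST; rewrite /upto /= sE => /negP; rewrite -ltNge => ST.
  move: Sb ST; rewrite /upto /=; have := jump_time_ge0 tau_gt0 n w; rewrite -/(S n w).
  case: (S n w) => [s| |] //; case: (tau n w) (tau_gt0 n w) => [r| |] // _ _.
    by rewrite -EFinD !(lee_fin, lte_fin) /= => ? ?; lra.
  by move=> _ _; exact: ltry.
- apply: pr_le.
  + by apply: measurableI => //; exact: mgt.
  + exact: measurableI.
  move=> w [[[Sb Sa] Iw] /= ST]; split; first by split.
  move: Sa; rewrite /upto /= sE => /negP; rewrite -ltNge => Sa; apply/negP; rewrite -ltNge.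
  move: Sa ST; have := jump_time_ge0 tau_gt0 n w; rewrite -/(S n w).
  case: (S n w) => [s| |] //; case: (tau n w) (tau_gt0 n w) => [r| |] // _ _.
  - by rewrite -EFinD !lte_fin => ? ?; lra.
  - by move=> _ _; rewrite addey // ltry.
  - by move=> _ _; rewrite addye // ltry.
  - by move=> _ _; rewrite addye // ltry.
Qed.

(** Both sides are Stieltjes integrals of exp (- q (T + h - s)) against the
    distribution of the n-th jump time s, and agree on short windows of s up to
    a small relative error. *)
Let memoryless n i (T h : R) : 0 <= T -> 0 <= h ->
  pr Q (upto n T `&` inside n i `&` ~` upto n.+1 (T + h)) =
  expR (- (q (iota i) * h)) * pr Q (upto n T `&` inside n i `&` ~` upto n.+1 T).
Proof.
move=> T0 h0; set k := q (iota i).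
have k0 : 0 <= k by exact: q_ge0.
pose W t T' := pr Q (upto n t `&` inside n i `&` ~` upto n.+1 T').
pose U t := pr Q (upto n t `&` inside n i).
have mW t T' : measurable (upto n t `&` inside n i `&` ~` upto n.+1 T').
  by apply: measurableI; [exact: measurableI|exact: measurableC].
have mU t : measurable (upto n t `&` inside n i) by exact: measurableI.
have upS (t d : R) : 0 <= d -> upto n t `<=` upto n (t + d).
  by move=> d0 w; rewrite /upto /= => /le_trans; apply; rewrite lee_fin lerDl.
have Wstep (t d T' : R) : 0 <= d ->
  W (t + d) T' - W t T' = pr Q (win n t (t + d) `&` inside n i `&` ~` upto n.+1 T').
  move=> d0; rewrite /W (@prDI _ _ _ Q _ (upto n t)) //; apply/eqP; rewrite subr_eq addrC.
  apply/eqP; congr (_ + _); congr pr.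
    apply/seteqP; split => w; first by move=> [[[? ?] ?] ?].
    by move=> [[[? ?] ?] ?].
  apply/seteqP; split => w; first by move=> [[[? ?] ?] ?].
  by move=> [[U1 ?] ?]; do !split => //; exact: upS.
have Ustep (t d : R) : 0 <= d -> U (t + d) - U t = pr Q (win n t (t + d) `&` inside n i).
  move=> d0; rewrite /U (@prDI _ _ _ Q _ (upto n t)) //; apply/eqP; rewrite subr_eq addrC.
  apply/eqP; congr (_ + _); congr pr.
    apply/seteqP; split => w; first by move=> [[? ?] ?].
    by move=> [[? ?] ?].
  apply/seteqP; split => w; first by move=> [[? ?] ?].
  by move=> [U1 ?]; do !split => //; exact: upS.
pose N t := W t (T + h) - expR (- (k * h)) * W t T.
have W0 T' : W (-1) T' = 0.
  rewrite /W (_ : _ `&` _ = set0) ?pr0 //; apply/seteqP; split => // w [[H _] _].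
  have := le_trans (jump_time_ge0 tau_gt0 n w) H.
  by rewrite lee_fin; lra.
(* Starting at -1 rather than 0 covers n = 0, where the jump time is 0. *)
have N0 : N (-1) = 0 by rewrite /N !W0 mulr0 subrr.
have key (t d : R) : 0 <= d -> t + d <= T -> `|N (t + d) - N t| <= k * d * (U (t + d) - U t).
  move=> d0 tdT.
  have -> : N (t + d) - N t = (W (t + d) (T + h) - W t (T + h)) -
    expR (- (k * h)) * (W (t + d) T - W t T) by rewrite /N; ring.
  rewrite !Wstep // Ustep //.
  have td : t <= t + d by lra.
  have tdTh : t + d <= T + h by lra.
  have /andP[l1 u1] := window_bounds n i td tdT.
  have /andP[l2 u2] := window_bounds n i td tdTh.
  have eh0 : 0 <= expR (- (k * h)) by exact: expR_ge0.
  have l3 := ler_wpM2l eh0 l1; have u3 := ler_wpM2l eh0 u1.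
  have P0 := pr_ge0 Q (win n t (t + d) `&` inside n i).
  move: l2 u2 l3 u3; rewrite -/k.
  set p := pr Q (win n t (t + d) `&` inside n i) in P0 *.
  rewrite !mulrA -!expRD.
  have -> : - (k * h) - k * (T - t) = - (k * (T + h - t)) by ring.
  have -> : - (k * h) - k * (T - (t + d)) = - (k * (T + h - (t + d))) by ring.
  set e1 := expR (- (k * (T + h - (t + d)))); set e2 := expR (- (k * (T + h - t))).
  have e21 : e2 = e1 * expR (- (k * d)) by rewrite -expRD; congr expR; ring.
  have e1_1 : e1 <= 1 by rewrite expR_le1 oppr_le0 mulr_ge0 // subr_ge0.
  have e1_0 : 0 <= e1 by exact: expR_ge0.
  have /andP[b0 b1] := expRN_bounds (mulr_ge0 k0 d0).
  have D12 : e1 - e2 <= k * d.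
    have -> : e1 - e2 = e1 * (1 - expR (- (k * d))) by rewrite e21; ring.
    by apply: le_trans b1; rewrite -[leRHS]mul1r ler_wpM2r.
  have D12p := ler_wpM2r P0 D12.
  move=> l2 u2 l3 u3; rewrite ler_norml; apply/andP; split; lra.
have NT : N T = 0.
  apply/eqP; rewrite -N0 eq_le; apply/andP; split.
    apply: (@telescoping_le _ N U k 1) => // [|t d _ d0 _ tdT]; first lra.
    by apply: le_trans (key _ _ d0 tdT); exact: ler_norm.
  rewrite -lerN2.
  apply: (@telescoping_le _ (fun t => - N t) U k 1) => // [|t d _ d0 _ tdT]; first lra.
  have := key _ _ d0 tdT; rewrite ler_norml => /andP[]; lra.
by move: NT; rewrite /N => /eqP; rewrite subr_eq0 => /eqP.
Qed.

Let stay n i t := upto n t `&` inside n i `&` ~` upto n.+1 t.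
Let F n i t := pr Q (stay n i t).
Let D n i t h := pr Q (win n t (t + h) `&` inside n i).

Let mstay n i t : measurable (stay n i t).
Proof. by apply: measurableI; [exact: measurableI|exact: measurableC]. Qed.

Let upto_le n (s t : R) : s <= t -> upto n s `<=` upto n t.
Proof. by move=> st w; rewrite /upto /= => /le_trans; apply; rewrite lee_fin. Qed.

Let uptoS n (t : R) : upto n.+1 t `<=` upto n t.
Proof. by move=> w; rewrite /upto /=; apply: le_trans; exact: jump_time_le. Qed.

(** At time t + h, either the n-th jump occurred before t and there was no jump
    since, or it occurred within h; in that case the next jump is later
    than t + h with probability at least exp (- q h). *)
Let F_step n i (t h : R) : 0 <= t -> 0 <= h ->
  expR (- (q (iota i) * h)) * (F n i t + D n i t h) <= F n i (t + h) <=
  expR (- (q (iota i) * h)) * F n i t + D n i t h.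
Proof.
move=> t0 h0; have th : t <= t + h by lra.
have -> : F n i (t + h) = expR (- (q (iota i) * h)) * F n i t +
    pr Q (win n t (t + h) `&` inside n i `&` ~` upto n.+1 (t + h)).
  rewrite -memoryless // /F (@prDI _ _ _ Q _ (upto n t)) //; congr (_ + _); congr pr.
    apply/seteqP; split => w; first by move=> [[[? ?] ?] ?].
    by move=> [[? ?] ?]; do !split => //; exact: (upto_le th).
  apply/seteqP; split => w; first by move=> [[[? ?] ?] ?].
  by move=> [[[? ?] ?] ?].
have /andP[] := window_bounds n i th (lexx (t + h)).
rewrite subrr mulr0 oppr0 expR0 mul1r (_ : t + h - t = h) -?/(D n i t h); last by ring.
move=> l u.
by rewrite mulrDr !lerD2l l u.
Qed.

(** The next jump occurs within h either from a state already occupied at t, or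
    after an earlier jump within h, which is a second-order event. *)
Let jump_bounds n i (t h : R) : 0 <= t -> 0 <= h ->
  (1 - expR (- (q (iota i) * h))) * F n i t <=
  pr Q (win n.+1 t (t + h) `&` inside n i) <=
  (1 - expR (- (q (iota i) * h))) * (F n i t + D n i t h).
Proof.
move=> t0 h0; have th : t <= t + h by lra.
have mX : measurable (win n.+1 t (t + h) `&` inside n i) by exact: measurableI.
have mWI : measurable (win n t (t + h) `&` inside n i) by exact: measurableI.
set e := expR _.
rewrite (@prDI _ _ _ Q _ (upto n t) mX (mupto n t)).
have -> : pr Q (win n.+1 t (t + h) `&` inside n i `&` upto n t) = (1 - e) * F n i t.
  rewrite mulrBl mul1r /e /F -memoryless // [in RHS](@prDI _ _ _ Q _ (upto n.+1 (t + h)) (mstay n i t) (mupto _ _)).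
  rewrite -addrA (_ : pr Q (stay n i t `&` ~` upto n.+1 (t + h)) - _ = 0) ?addr0.
    congr pr; apply/seteqP; split => w; first by move=> [[[? ?] ?] ?]; do !split => //.
    by move=> [[[? ?] ?] ?]; do !split => //.
  apply/eqP; rewrite subr_eq0; apply/eqP; congr pr; apply/seteqP; split => w.
    by move=> [[[? ?] ?] ?]; do !split => //.
  move=> [[Hu Hi] nu1]; split => //; split; first by split.
  by move=> H; apply: nu1; exact: (upto_le th).
have -> : pr Q (win n.+1 t (t + h) `&` inside n i `&` ~` upto n t) =
    D n i t h - pr Q (win n t (t + h) `&` inside n i `&` ~` upto n.+1 (t + h)).
  rewrite /D [X in X - _](@prDI _ _ _ Q _ (upto n.+1 (t + h)) mWI (mupto _ _)) addrK.
  congr pr; apply/seteqP; split => w.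
    by move=> [[[? ?] ?] ?]; do !split => //; exact: uptoS.
  move=> [[[Hu nu1] Hi] Hv]; split; last by [].
  by split => //; split => // H; apply: nu1; exact: uptoS.
have /andP[] := window_bounds n i th (lexx (t + h)).
rewrite subrr mulr0 oppr0 expR0 mul1r (_ : t + h - t = h) -?/(D n i t h); last by ring.
rewrite -/e => l u.
by apply/andP; split; lra.
Qed.

Let D_succ n j (t h : R) :
  D n.+1 j t h = \sum_i jp (iota i) (iota j) * pr Q (win n.+1 t (t + h) `&` inside n i).
Proof.
rewrite /D (@pr_partition _ _ _ Q I _ (fun i => [set w | Y n w = iota i])); first last.
- by move=> w [_ [H _]]; exact: H.
- by move=> i i' w /= -> /iota_inj.
- by move=> i; exact: Y_meas.
- exact: measurableI.
apply: eq_bigr => i _; rewrite -(inside_step i j (@win_gen n.+1 t (t + h))).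
congr pr; apply/seteqP; split => w.
  move=> [[W [H1 H2]] H3]; split => //; split => //; split => //.
  by move=> k kn; apply: H1; exact: leqW.
move=> [[W [H1 H2]] H3]; split => //; split => //; split => //.
move=> k; rewrite leq_eqVlt => /orP[/eqP ->|]; first by exists j.
exact: H1.
Qed.

Let D0 j (t h : R) : 0 <= t -> D 0 j t h = 0.
Proof.
move=> t0; rewrite /D (_ : _ `&` _ = set0) ?pr0 //; apply/seteqP; split => // w.
by move=> [[_ H] _]; apply: H; rewrite /upto /= /S /jump_time big_nil lee_fin.
Qed.

Definition killed_position (i : I) (t : R) : set Omega :=
  [set w | exists n, [/\ (forall k, (k <= n)%N -> exists j, Y k w = iota j),
    Y n w = iota i & (jump_time tau n w <= t%:E < jump_time tau n.+1 w)%E]].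

Let killed_positionE i t : killed_position i t = \bigcup_n stay n i t.
Proof.
apply/seteqP; split => w.
  move=> [n [H1 H2 /andP[H3 H4]]]; exists n => //; split; first by split.
  by apply/negP; rewrite -ltNge.
move=> [n _ [[H3 [H1 H2]] H4]]; exists n; split => //; apply/andP; split => //.
by rewrite ltNge; apply/negP.
Qed.

Lemma measurable_killed_position i t : measurable (killed_position i t).
Proof. by rewrite killed_positionE; apply: bigcupT_measurable => n. Qed.

Let occ N i t := \big[setU/set0]_(n < N) stay n i t.
Let FN N i t := \sum_(n < N) F n i t.

Let mocc N i t : measurable (occ N i t).
Proof. exact: bigsetU_measurable. Qed.

Let pr_occ N i t : pr Q (occ N i t) = FN N i t.
Proof.
rewrite /occ /FN; elim: N => [|N IH]; first by rewrite !big_ord0 pr0.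
rewrite [in RHS]big_ord_recr /= -IH.
rewrite (@prDI _ _ _ Q _ (occ N i t) (mocc N.+1 i t) (mocc N i t)).
congr (_ + _); congr pr; rewrite /occ big_ord_recr /=.
  by apply/seteqP; split => w; [case|move=> ?; split => //; left].
apply/seteqP; split => w; first by move=> [[|//] +] => /[swap].
move=> H; split; first by right.
rewrite -(bigcup_mkord N (fun n => stay n i t)) => -[n /= nN [_ H']].
by case: H => [[H _] _]; apply: H'; apply: le_trans H; exact: jump_time_le.
Qed.

Let FN_bounds N i t : 0 <= FN N i t <= 1.
Proof. by rewrite -pr_occ pr_ge0 pr_le1. Qed.

Let FN_cvg i t : FN N i t @[N --> \oo] --> pr Q (killed_position i t).
Proof.
under eq_fun do rewrite -pr_occ.
apply: fine_cvg.
have := @nondecreasing_cvg_mu _ _ _ Q (fun N => occ N i t).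
have -> : \bigcup_N occ N i t = killed_position i t.
  rewrite killed_positionE; apply/seteqP; split => w.
    by move=> [N _]; rewrite /occ -(bigcup_mkord N (fun n => stay n i t)) => -[n _ ?]; exists n.
  move=> [n _ ?]; exists n.+1 => //; rewrite /occ.
  by rewrite -(bigcup_mkord n.+1 (fun n => stay n i t)); exists n => //=.
rewrite -prE; last exact: measurable_killed_position.
apply => //; first exact: measurable_killed_position.
move=> m n mn; apply/subsetPset => w; rewrite /occ.
rewrite -(bigcup_mkord m (fun n => stay n i t)) -(bigcup_mkord n (fun n => stay n i t)).
by move=> [k /= km H]; exists k => //=; exact: leq_trans mn.
Qed.

Let q_sum := \sum_i q (iota i).
Let jp_sum := \sum_i \sum_j jp (iota i) (iota j).

Let q_le i : q (iota i) <= q_sum.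
Proof. by rewrite /q_sum (bigD1 i) //= lerDl sumr_ge0. Qed.

Let jp_sum_ge0 : 0 <= jp_sum.
Proof. by apply: sumr_ge0 => i _; exact: sumr_ge0. Qed.

Let q_sum_ge0 : 0 <= q_sum.
Proof. by apply: sumr_ge0. Qed.

Let jp_col_le j (a : I -> R) (b : R) : (forall i, a i <= b) ->
  \sum_i jp (iota i) (iota j) * a i <= (\sum_i jp (iota i) (iota j)) * b.
Proof. by move=> ab; rewrite mulr_suml; apply: ler_sum => i _; rewrite ler_wpM2l. Qed.

Let jp_col_le_sum j : \sum_i jp (iota i) (iota j) <= jp_sum.
Proof.
rewrite /jp_sum; apply: ler_sum => i _.
by rewrite (bigD1 j) //= lerDl sumr_ge0.
Qed.

(** The constant for the probability of a jump within h, uniformly in the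
    number of jumps: the bound 2 c h for h <= hmax reproduces itself under
    [DN_succ]. *)
Let c := jp_sum * q_sum.
Let c_ge0 : 0 <= c. Proof. exact: mulr_ge0. Qed.
Let hmax : R := (2 * (c + 1))^-1.

Let hmax_gt0 : 0 < hmax.
Proof. by rewrite invr_gt0; have := c_ge0; lra. Qed.

Section Increment.
Variables (t h : R).
Hypotheses (t_ge0 : 0 <= t) (h_ge0 : 0 <= h) (h_le : h <= hmax).

Let ch : 2 * c * h <= 1.
Proof.
have c1 : 0 < 2 * (c + 1) by have := c_ge0; lra.
have : h * (2 * (c + 1)) <= 1 by rewrite -ler_pdivlMr // div1r.
by have := h_ge0; lra.
Qed.

Let e i := expR (- (q (iota i) * h)).
Let e_bounds i : 0 <= 1 - e i <= q_sum * h.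
Proof.
have /andP[-> u] := expRN_bounds (mulr_ge0 (q_ge0 (iota i)) h_ge0).
by apply: le_trans u _; rewrite ler_wpM2r.
Qed.

Let e_quad i : `|1 - e i - q (iota i) * h| <= 2 * (q_sum * h) ^+ 2.
Proof.
apply: le_trans (expRN_quad (mulr_ge0 (q_ge0 (iota i)) h_ge0)) _.
rewrite ler_pM2l // lerXn2r ?nnegrE ?mulr_ge0 // ler_wpM2r //.
Qed.

Let DN N i := \sum_(n < N) D n i t h.
Let G N i := \sum_(n < N) pr Q (win n.+1 t (t + h) `&` inside n i).

Let DN_ge0 N i : 0 <= DN N i.
Proof. by apply: sumr_ge0 => n _; exact: pr_ge0. Qed.

Let G_bounds N i : (1 - e i) * FN N i t <= G N i <= (1 - e i) * (FN N i t + DN N i).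
Proof.
rewrite /G /FN /DN -big_split /= !mulr_sumr; apply/andP.
by split; apply: ler_sum => n _; have /andP[] := jump_bounds n i t_ge0 h_ge0.
Qed.

Let DN_succ N j : DN N.+1 j = \sum_i jp (iota i) (iota j) * G N i.
Proof.
rewrite /DN big_ord_recl /= D0 // add0r; under eq_bigr do rewrite /bump /= D_succ.
by rewrite exchange_big /=; apply: eq_bigr => i _; rewrite mulr_sumr.
Qed.

Let DN_le N j : DN N j <= 2 * c * h.
Proof.
elim: N j => [|N IH] j; first by rewrite /DN big_ord0 mulr_ge0 // mulr_ge0.
rewrite DN_succ.
have Gle i : G N i <= 2 * (q_sum * h).
  have /andP[_ u] := G_bounds N i; apply: le_trans u _.
  have /andP[e0 e1] := e_bounds i.
  have /andP[F0 F1] := FN_bounds N i t.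
  rewrite mulrC ler_pM // ?addr_ge0 //.
  by have := IH i; have := ch; lra.
apply: le_trans (jp_col_le j Gle) _.
have -> : 2 * c * h = jp_sum * (2 * (q_sum * h)) by rewrite /c; ring.
by rewrite ler_wpM2r // !mulr_ge0.
Qed.

Let FN_step N i :
  e i * (FN N i t + DN N i) <= FN N i (t + h) <= e i * FN N i t + DN N i.
Proof.
rewrite /FN /DN -big_split /= !mulr_sumr -big_split /=; apply/andP.
by split; apply: ler_sum => n _; have /andP[] := F_step n i t_ge0 h_ge0.
Qed.

Let err := 2 * q_sum ^+ 2 + 2 * q_sum * c.

Let errE : err * h ^+ 2 = 2 * q_sum ^+ 2 * h ^+ 2 + 2 * q_sum * c * h ^+ 2.
Proof. by rewrite /err; ring. Qed.

(** The three error terms: two jumps within h, the expansion of exp (- q h) at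
    the state that is left, and the same two effects at the states from which
    j is entered. *)
Let FN_flow N j :
  `|FN N.+1 j (t + h) - FN N.+1 j t -
    h * (\sum_i q (iota i) * jp (iota i) (iota j) * FN N i t - q (iota j) * FN N.+1 j t)|
  <= (1 + jp_sum) * err * h ^+ 2.
Proof.
set A := FN N.+1 j (t + h); set B := FN N.+1 j t; set S' := \sum_i _.
have -> : A - B - h * (S' - q (iota j) * B) =
  ((A - e j * B - DN N.+1 j) + (q (iota j) * h - (1 - e j)) * B) + (DN N.+1 j - h * S') by ring.
have -> : (1 + jp_sum) * err * h ^+ 2 = err * h ^+ 2 + jp_sum * (err * h ^+ 2) by ring.
apply: le_trans (ler_normD _ _) _; apply: lerD.
  apply: le_trans (ler_normD _ _) _.
  rewrite [leLHS]addrC errE; apply: lerD.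
    rewrite normrM distrC -[leRHS]mulr1; have /andP[B0 B1] := FN_bounds N.+1 j t.
    rewrite (ger0_norm B0) ler_pM //.
    by apply: le_trans (e_quad j) _; rewrite exprMn mulrA.
  have /andP[l u] := FN_step N.+1 j.
  have E : (1 - e j) * DN N.+1 j <= 2 * q_sum * c * h ^+ 2.
    have -> : 2 * q_sum * c * h ^+ 2 = q_sum * h * (2 * c * h) by ring.
    by have /andP[? ?] := e_bounds j; rewrite ler_pM.
  move: l u; rewrite -/A -/B => l u; rewrite ler_norml; apply/andP; split; last first.
    have /andP[e0 _] := e_bounds j; have := mulr_ge0 e0 (DN_ge0 N.+1 j); lra.
  lra.
rewrite DN_succ mulr_sumr -sumrB.
apply: le_trans (ler_norm_sum _ _ _) _.
apply: (@le_trans _ _ (\sum_i jp (iota i) (iota j) * (err * h ^+ 2))); last first.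
  rewrite -mulr_suml ler_wpM2r //.
  by rewrite /err mulr_ge0 ?sqr_ge0 // addr_ge0 // mulr_ge0 ?sqr_ge0 // mulr_ge0.
apply: ler_sum => i _.
have -> : jp (iota i) (iota j) * G N i - h * (q (iota i) * jp (iota i) (iota j) * FN N i t) =
  jp (iota i) (iota j) * ((G N i - (1 - e i) * FN N i t) + (1 - e i - q (iota i) * h) * FN N i t).
  by ring.
rewrite normrM ger0_norm // ler_wpM2l //.
apply: le_trans (ler_normD _ _) _; rewrite [leLHS]addrC errE; apply: lerD.
  rewrite normrM -[leRHS]mulr1; have /andP[B0 B1] := FN_bounds N i t.
  rewrite (ger0_norm B0) ler_pM //.
  by apply: le_trans (e_quad i) _; rewrite exprMn mulrA.
have /andP[l u] := G_bounds N i; have /andP[e0 e1] := e_bounds i.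
rewrite ger0_norm ?subr_ge0 //.
have E : (1 - e i) * DN N i <= 2 * q_sum * c * h ^+ 2.
  have -> : 2 * q_sum * c * h ^+ 2 = q_sum * h * (2 * c * h) by ring.
  by rewrite ler_pM.
lra.
Qed.

Lemma killed_position_increment j :
  `|pr Q (killed_position j (t + h)) - pr Q (killed_position j t) -
    h * (\sum_i q (iota i) * jp (iota i) (iota j) * pr Q (killed_position i t)
         - q (iota j) * pr Q (killed_position j t))|
  <= (1 + jp_sum) * err * h ^+ 2.
Proof.
pose u N := `|FN N.+1 j (t + h) - FN N.+1 j t -
    h * (\sum_i q (iota i) * jp (iota i) (iota j) * FN N i t - q (iota j) * FN N.+1 j t)|.
have cS i s : FN N.+1 i s @[N --> \oo] --> pr Q (killed_position i s).
  by have := FN_cvg (i := i) (t := s); rewrite -(cvg_shiftS (fun N => FN N i s)); exact.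
apply: (@cvgr_to_le _ \oo _ _ u); last by apply: nearW => N; exact: FN_flow.
apply: cvg_norm; apply: cvgB; first by apply: cvgB; exact: cS.
apply: cvgMl_tmp; apply: cvgB; last by apply: cvgMl_tmp; exact: cS.
apply: cvg_big => [|i _]; first exact: add_continuous.
by apply: cvgMl_tmp; exact: FN_cvg.
Qed.

End Increment.

(** The forward equation, by letting the number N of jumps tend to infinity:
    the error in [FN_flow] does not depend on N. *)
Lemma killed_position_flow : exists C h0 : R, 0 < h0 /\
  forall t h j, 0 <= t -> 0 <= h -> h <= h0 ->
  `|pr Q (killed_position j (t + h)) - pr Q (killed_position j t) -
    h * (\sum_i q (iota i) * jp (iota i) (iota j) * pr Q (killed_position i t)
         - q (iota j) * pr Q (killed_position j t))| <= C * h ^+ 2.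
Proof.
exists ((1 + jp_sum) * (2 * q_sum ^+ 2 + 2 * q_sum * c)), hmax; split => // t h j t0 h0 hh.
exact: killed_position_increment.
Qed.

Lemma killed_position0 j : pr Q (killed_position j 0) = (iota j == x)%:R.
Proof.
have -> : killed_position j 0 = [set w | Y 0%N w = iota j].
  apply/seteqP; split => w.
    move=> [[|n] [H1 H2 /andP[H3 H4]]] //; exfalso; move: H3.
    have := jump_time_le tau_gt0 w (ltn0Sn n).
    rewrite leNgt => /negP H3 H5; apply: H3; apply: le_lt_trans H5 _.
    by rewrite /jump_time big_nat1.
  move=> H; exists 0%N; split => //.
    by move=> k; rewrite leqn0 => /eqP ->; exists j.
  by rewrite /jump_time big_nil big_nat1 lexx /=.
have := @law 0%N (fun=> iota j) (fun=> 0) (fun=> lexx 0).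
rewrite big_ord0 big_ord_recl big_ord0 mulr0 oppr0 expR0 !mulr1 => E.
have <- : fine (iota j == x)%:R%:E = (iota j == x)%:R :> R by [].
rewrite -E /pr; congr (fine (Q _)); apply/seteqP; split => w /=.
  by move=> H k; rewrite leqn0 => /eqP ->.
by move=> /(_ 0%N (leqnn _))[].
Qed.

End ChainLaw.

(** * From a recursion for tails to a Gaussian tail *)

Section Iteration.
Variable R : realType.

Lemma exists_expn_between (G : R) : 1 < G -> exists n : nat,
  [/\ (0 < n)%N, 2 < G ^+ n & G ^+ n <= 2 * G].
Proof.
move=> G1.
have ex : exists n, 2 < G ^+ n.
  have G10 : 0 < G - 1 by lra.
  pose n := (Num.trunc ((G - 1)^-1)).+1; exists n.
  have nS : (G - 1)^-1 < n%:R by exact: truncnS_gt.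
  have B : 1 + (G - 1) *+ n <= G ^+ n.
    rewrite [in leRHS](_ : G = 1 + (G - 1)); last by ring.
    elim: n {nS} => [|n IH]; first by rewrite mulr0n addr0 expr0.
    rewrite exprS mulrSr; apply: le_trans (ler_wpM2l _ IH); last by lra.
    have : 0 <= (G - 1) * ((G - 1) *+ n) by rewrite mulr_ge0 ?mulrn_wge0 // ltW.
    by set X := _ *+ n; lra.
  apply: lt_le_trans B; rewrite -mulr_natr.
  have : 1 < (G - 1) * n%:R by rewrite mulrC -ltr_pdivrMr // div1r.
  lra.
exists (ex_minn ex); case: ex_minnP => n n2 nmin.
have n0 : (0 < n)%N by case: n n2 {nmin} => //; rewrite expr0; lra.
split => //; case: n n0 nmin {n2} => // n _ nmin.
rewrite exprSr ler_wpM2r //; first lra.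
rewrite leNgt; apply/negP => /nmin; by rewrite ltnn.
Qed.

(** Take the last scale t / G^K that is at least T. *)
Lemma exists_last_scale (G t T : R) : 2 <= G -> 0 < T -> T <= t -> exists K : nat,
  T <= t / G ^+ K /\ t / G ^+ K <= G * T.
Proof.
move=> G2 T0 Tt.
have G0 : 0 < G by lra.
have ex : exists n, t / G ^+ n.+1 < T.
  exists (Num.trunc (t / T)); set n := Num.trunc _.
  have nS : t / T < n.+1%:R by exact: truncnS_gt.
  rewrite ltr_pdivrMr ?exprn_gt0 // mulrC -ltr_pdivrMr //.
  apply: lt_le_trans nS _.
  apply: le_trans (_ : 2 ^+ n.+1 <= _); last by rewrite lerXn2r ?nnegrE // ltW.
  by rewrite -natrX ler_nat ltnW // ltn_expl.
exists (ex_minn ex); case: ex_minnP => n n2 nmin; split.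
  case: n n2 nmin => [|n] _ nmin; first by rewrite expr0 divr1.
  by rewrite leNgt; apply/negP => /nmin; rewrite ltnn.
move: n2; rewrite exprS invfM mulrCA ltr_pdivrMl // => /ltW.
by [].
Qed.

Lemma inv_le_1024 (y : R) : 1024 <= y -> y^-1 <= 1 / 1024.
Proof.
move=> h; have y0 : 0 < y by lra.
by rewrite -div1r ler_pdivrMr //; lra.
Qed.

(** What the heat kernel estimates say about the mass J r s outside radius r
    at time s, when 1 / f bounds the diagonal: Davies' method between two
    times and two radii, Davies' method from time 0, and the semigroup
    property. *)
Definition tail_recursion (f : R -> R) (J : R -> R -> R) : Prop :=
  [/\ forall r r' s s' lam : R, 0 <= lam -> lam <= 1 / 2 ->
        r' <= r -> 0 < s' -> s' <= s ->
        J r s <= expR (4 * lam ^+ 2 * (s - s')) *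
          (J r' s' + expR (- (2 * lam * (r - r'))) / f (2 * s')),
      forall r s lam : R, 0 <= lam -> lam <= 1 / 2 -> 0 <= s ->
        J r s <= expR (4 * lam ^+ 2 * s - 2 * lam * r)
    & forall r s : R, 0 < s -> J r s <= (f (2 * s))^-1].

(** The last three summands come from the regimes treated below: times before
    T1, the last link of a chain of scales, and the near-diagonal regime. *)
Definition tail_constant (A G eps : R) : R :=
  1 + A * expR 1 + A * expR (eps * ln G + eps * ln (128 * G * (eps + 1)))
  + expR (4 * 10 ^- 7 * (512 ^+ 2 / 4 + G + ln (2 * A) / (4 * 10 ^- 7))).

Variables (A G eps : R).
Hypotheses (A1 : 1 <= A) (G2 : 2 <= G) (eps0 : 0 <= eps).

Let th : R := 4 * 10 ^- 7.
(* lam_0 = d / (N t): N is so large that the cost 4 lam^2 of Davies' method is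
   small compared with its gain, and that the sum of all costs is. *)
Let N : R := 512.
Let B : R := N ^+ 2 / 4.
Let K0 : R := B + G + ln (2 * A) / th.
Let M : R := 128 * G * (eps + 1).
Let C2 : R := eps * ln M.
Let C : R := 1 + A * expR 1 + A * expR (eps * ln G + C2) + expR (th * K0).

Let G0 : 0 < G. Proof. by have := G2; lra. Qed.
Let A0 : 0 < A. Proof. by have := A1; lra. Qed.
Let th0 : 0 < th. Proof. by rewrite /th mulr_gt0 // invr_gt0 exprn_gt0. Qed.
Let N0 : 0 < N. Proof. by []. Qed.
Let B0 : 0 < B. Proof. by rewrite divr_gt0 // exprn_gt0. Qed.
Let th_le : th <= (16 * B)^-1.
Proof.
rewrite /th ler_pdivrMr ?exprn_gt0 // mulrC ler_pdivlMr ?mulr_gt0 //.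
have N10 : N <= 6 * 10 ^+ 2 by rewrite -natrX -natrM ler_nat.
have NN : N ^+ 2 <= (6 * 10 ^+ 2) ^+ 2.
  by rewrite lerXn2r ?nnegrE ?mulr_ge0 ?exprn_ge0 // ltW.
rewrite exprMn -exprM in NN.
have -> : 4 * (16 * B) = 16 * N ^+ 2 by rewrite /B; field.
have -> : 10 ^+ 7 = 10 * (10 * (10 * 10 ^+ (2 * 2)%N)) :> R by rewrite -!exprS.
have X0 : 0 <= (10 : R) ^+ (2 * 2)%N by rewrite exprn_ge0.
lra.
Qed.
Let ln2A : 0 <= ln (2 * A). Proof. by rewrite ln_ge0 //; have := A1; lra. Qed.
Let M1 : 1 <= M.
Proof.
rewrite /M; have := mulr_ge0 (ltW G0) eps0; have := G2; lra.
Qed.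
Let C1 : 1 <= C.
Proof.
rewrite /C; have := expR_gt0 (th * K0); have := mulr_gt0 A0 (expR_gt0 1).
by have := mulr_gt0 A0 (expR_gt0 (eps * ln G + C2)); lra.
Qed.

Variables (f : R -> R) (J : R -> R -> R) (T1 t d : R).
Hypothesis f_mono : forall s s', 0 <= s -> s <= s' -> f s <= f s'.
Hypothesis f_gt0 : forall s, 0 < s -> 0 < f s.
Hypothesis T10 : 0 <= T1.
Hypothesis t0 : 0 < t.
Hypothesis d0 : 0 <= d.
Hypothesis dt : d <= t.
Hypothesis T1t : 2 ^+ 10 * eps * T1 * ln (Num.max T1 1) <= t.
Hypothesis f_reg : forall s, T1 <= s -> 0 < s -> s < t / G ->
  f (G * s) / f s <= A * (f t / f (t / G)).
Hypothesis f_growth : forall s, T1 <= s -> s <= Num.max T1 t -> f s <= A * s `^ eps.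

Hypothesis J_rec : tail_recursion f J.

Let J_diag (r s : R) : 0 < s -> J r s <= (f (2 * s))^-1.
Proof. by case: J_rec => _ _; apply. Qed.

Let D := d ^+ 2 / (2 * t).
Let L := f t / f (t / G).

Let tG0 : 0 < t / G. Proof. exact: divr_gt0. Qed.
Let ftG0 : 0 < f (t / G). Proof. exact: f_gt0. Qed.
Let L1 : 1 <= L.
Proof.
rewrite /L ler_pdivlMr // mul1r; apply: f_mono; first exact: ltW.
by rewrite ler_pdivrMr // ler_peMr ?ltW //; have := G2; lra.
Qed.

Let D0 : 0 <= D.
Proof. by rewrite divr_ge0 ?sqr_ge0 // mulr_ge0 // ltW. Qed.

(** The gain of f t over f (t / G) pays for the exponential. *)
Let near_diagonal : th * D <= ln L + th * K0 ->
  J (d / 2) (t / 2) <= C / f (t / G) * expR (- (th * D)).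
Proof.
move=> H.
have L0 : 0 < L by have := L1; lra.
apply: le_trans (J_diag _ _) _; first by rewrite divr_gt0.
rewrite mulrCA divff // mulr1.
have -> : (f t)^-1 = (f (t / G))^-1 * L^-1.
  by rewrite /L invfM invrK mulrCA mulVf ?mulr1 // gt_eqF.
rewrite [C / _]mulrC -mulrA ler_pM2l ?invr_gt0 //.
rewrite -[L in L^-1]lnK ?posrE // -expRN.
apply: le_trans (_ : expR (th * K0) * expR (- (th * D)) <= _).
  by rewrite -expRD ler_expR; lra.
rewrite ler_wpM2r ?expR_ge0 // /C.
have := mulr_gt0 A0 (expR_gt0 1).
by have := mulr_gt0 A0 (expR_gt0 (eps * ln G + C2)); lra.
Qed.

Let davies (r s : R) : 0 <= r -> r <= 2 * s -> 0 < s ->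
  J r s <= expR (- (r ^+ 2 / (4 * s))).
Proof.
move=> r0 rs s0; have [_ J_davies _] := J_rec.
have := J_davies r s (r / (4 * s)).
have -> : 4 * (r / (4 * s)) ^+ 2 * s - 2 * (r / (4 * s)) * r = - (r ^+ 2 / (4 * s)).
  by field; rewrite gt_eqF.
apply; last exact: ltW.
  by rewrite divr_ge0 // mulr_ge0 // ltW.
rewrite ler_pdivrMr ?mulr_gt0 //; lra.
Qed.

Let powR_le_expR (s x : R) : 0 <= s -> (0 < s -> eps * ln s <= x) -> 0 <= x ->
  s `^ eps <= expR x.
Proof.
rewrite le_eqVlt => /orP[/eqP <- _ x0|s0 /(_ s0) H _].
  have [->|e0] := eqVneq eps 0; first by rewrite powRr0 -expR0 ler_expR.
  by rewrite powR0 // expR_ge0.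
by rewrite /powR gt_eqF // ler_expR.
Qed.

(** If t < T1, the lower bound on t forces T1 ^ eps <= e, so f is bounded and
    Davies' bound suffices. *)
Let before_T1 : t < T1 -> th * D <= D / 4 ->
  J (d / 2) (t / 2) <= C / f (t / G) * expR (- (th * D)).
Proof.
move=> tT1 thD.
have T1p : 0 < T1 by apply: lt_trans tT1.
have fb : f (t / G) <= A * expR 1.
  apply: le_trans (_ : f T1 <= _).
    apply: f_mono; first exact: ltW.
    apply: le_trans (ltW tT1); rewrite ler_pdivrMr // ler_peMr ?ltW //.
    by have := G2; lra.
  apply: le_trans (f_growth _ _) _ => //; first by rewrite le_max lexx.
  rewrite ler_pM2l //; apply: powR_le_expR => // _.
  have [T11|T11] := leP T1 1.
    apply: le_trans (_ : 0 <= 1) => //; apply: mulr_ge0_le0 => //; exact: ln_le0.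
  move: T1t; rewrite max_l; last exact: ltW.
  move=> H.
  have e1 : eps * ln T1 * T1 <= T1.
    have : 0 <= eps * ln T1 * T1 by rewrite !mulr_ge0 // ln_ge0 // ltW.
    have E : 2 ^+ 10 * eps * T1 * ln T1 = 1024 * (eps * ln T1 * T1) by ring.
    rewrite E in H.
    lra.
  by rewrite -(ler_pM2r T1p) mul1r.
apply: le_trans (davies _ _ _) _.
- by rewrite divr_ge0.
- by have := dt; have := d0; lra.
- by rewrite divr_gt0.
have -> : (d / 2) ^+ 2 / (4 * (t / 2)) = D / 4 by rewrite /D; field; rewrite gt_eqF.
rewrite [leRHS]mulrAC; apply: le_trans (_ : expR (- (th * D)) <= _).
  by rewrite ler_expR lerN2.
rewrite ler_pdivlMr // mulrC ler_wpM2r ?expR_ge0 //; apply: le_trans fb _.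
rewrite /C; have := expR_gt0 (th * K0).
by have := mulr_gt0 A0 (expR_gt0 (eps * ln G + C2)); lra.
Qed.

Section Chaining.
Hypothesis T1_le_t : T1 <= t.
Hypothesis D_large : K0 < D.
Hypothesis D_log : ln L < th * D.

Let D_gt : B + G <= D.
Proof.
apply: le_trans (ltW D_large); rewrite /K0 lerDl divr_ge0 // ltW //.
Qed.

Let d_gt0 : 0 < d.
Proof.
rewrite lt_neqAle d0 andbT; apply/eqP => dE; have := D_gt.
by rewrite /D -dE expr0n /= mul0r; have := G2; have := B0; lra.
Qed.

Let logAL : ln (2 * A * L) <= 2 * th * D.
Proof.
have L0 : 0 < L by have := L1; lra.
have A2 : 0 < 2 * A by rewrite mulr_gt0.
rewrite lnM ?posrE //.
have : ln (2 * A) <= th * D.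
  rewrite -ler_pdivrMl // mulrC; apply: le_trans (ltW D_large).
  by rewrite /K0 lerDr; have := G2; have := B0; lra.
by have := D_log; lra.
Qed.

Let AL1 : 1 <= A * L.
Proof. by rewrite -[leLHS]mul1r ler_pM. Qed.

(** By regularity each of the k ratios of f between consecutive scales below
    t / G is at most A L. *)
Let f_chain k : T1 <= t / G ^+ k.+1 -> f (t / G) <= (A * L) ^+ k * f (t / G ^+ k.+1).
Proof.
elim: k => [|k IH] H; first by rewrite expr0 mul1r expr1.
have Gk : 0 < G ^+ k.+1 by rewrite exprn_gt0.
have s0 : 0 < t / G ^+ k.+2 by rewrite divr_gt0 // exprn_gt0.
have E : G * (t / G ^+ k.+2) = t / G ^+ k.+1.
  by rewrite [in LHS]exprS; field; rewrite !gt_eqF.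
have lt1 : t / G ^+ k.+2 < t / G.
  rewrite ltr_pM2l // ltf_pV2 ?posrE ?exprn_gt0 // -[ltLHS]expr1.
  by rewrite ltr_eXn2l //; have := G2; lra.
have H' : T1 <= t / G ^+ k.+1.
  apply: le_trans H _; rewrite -E ler_peMl ?ltW //; have := G2; lra.
apply: le_trans (IH H') _; rewrite [(A * L) ^+ k.+1]exprSr -mulrA ler_pM2l; last first.
  by rewrite exprn_gt0 // (lt_le_trans ltr01 AL1).
by have := f_reg H s0 lt1; rewrite E ler_pdivrMr // f_gt0.
Qed.

(* The k-th step goes from radius R_ k and time tau k to R_ k.+1 and tau k.+1.
   It gains the exponent 32 w k and costs at most w k; the target exponent
   16 w k grows by the factor 9/8, hence by 2 w k, at each step. *)
Let R_ k := d / 2 * (1 / 2 + 1 / 2 * (3 / 4) ^+ k).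
Let tau k := t / (2 * G ^+ k).
Let lam k := (3 / 2) ^+ k * d / (N * t).
Let w k := (9 / 8) ^+ k * D / B.

Let Gk0 k : 0 < G ^+ k. Proof. exact: exprn_gt0. Qed.

Let tau0 k : 0 < tau k. Proof. by rewrite divr_gt0 // mulr_gt0. Qed.

Let tau2 k : 2 * tau k = t / G ^+ k.
Proof. by rewrite /tau; field; rewrite gt_eqF. Qed.

Let tauS k : tau k.+1 <= tau k.
Proof.
rewrite /tau ler_pM2l // lef_pV2 ?posrE ?mulr_gt0 // ler_pM2l // exprS.
by rewrite ler_peMl ?ltW //; have := G2; lra.
Qed.

Let R_gap k : R_ k - R_ k.+1 = d / 2 * ((3 / 4) ^+ k / 8).
Proof. by rewrite /R_ exprS; field. Qed.

Let lam_gap k : 2 * lam k * (R_ k - R_ k.+1) = N / 16 * w k.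
Proof.
rewrite R_gap /lam /w.
have -> : (9 / 8 : R) ^+ k = (3 / 2) ^+ k * (3 / 4) ^+ k.
  by rewrite -exprMn; congr (_ ^+ k); field.
rewrite /D /B; set X := (3 / 2) ^+ k; set Y := (3 / 4) ^+ k.
by field; rewrite !gt_eqF.
Qed.

Let expn_le_G (b : R) k : 0 <= b -> b <= 2 -> b ^+ k <= G ^+ k.
Proof. by move=> b0 b2; rewrite lerXn2r ?nnegrE //; have := G2; lra. Qed.

Let lam_cost k : 4 * lam k ^+ 2 * (tau k - tau k.+1) <= w k.
Proof.
apply: le_trans (_ : 4 * lam k ^+ 2 * tau k <= _).
  apply: ler_wpM2l; first by rewrite mulr_ge0 ?sqr_ge0.
  by rewrite gerBl ltW.
have -> : 4 * lam k ^+ 2 * tau k = (9 / 4 / G) ^+ k * D / B.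
  have -> : (9 / 4 / G) ^+ k = ((3 / 2) ^+ k) ^+ 2 / G ^+ k.
    rewrite expr_div_n; congr (_ / _).
    by rewrite -exprM mulnC exprM; congr (_ ^+ k); field.
  rewrite /lam /tau /D /B; set X := (3 / 2) ^+ k; set Y := G ^+ k.
  have Y0 : 0 < Y by exact: Gk0.
  by field; rewrite !gt_eqF.
rewrite /w ler_pM2r ?invr_gt0 // ler_wpM2r //.
have q0 : 0 <= 9 / 4 / G by rewrite divr_ge0 // ltW.
rewrite lerXn2r ?nnegrE // ler_pdivrMr //.
by have := G2; lra.
Qed.

Let w_ge k : D * (1 + k%:R / 8) <= B * w k.
Proof.
have -> : B * w k = (9 / 8) ^+ k * D by rewrite /w mulrC divfK ?gt_eqF.
rewrite mulrC ler_wpM2r //.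
elim: k => [|k IH]; first by rewrite mul0r addr0 expr0.
rewrite exprS -natr1; have k0 : 0 <= k%:R :> R by [].
by have := IH; lra.
Qed.

Let b k := expR (- (16 * w k)) / f (t / G).

(** After the cost w, the exponents 18 w = 16 w k.+1 and 32 w - w (the second
    w bounds the loss (A L)^k) leave 17 w and 30 w, both beyond 16 w. *)
Let chain_step k : T1 <= t / G ^+ k.+1 -> d <= t / G ^+ k.+1 ->
  J (R_ k.+1) (tau k.+1) <= C * b k.+1 -> J (R_ k) (tau k) <= C * b k.
Proof.
move=> HT Hd IH.
have lam_ge0 : 0 <= lam k by rewrite divr_ge0 ?mulr_ge0 ?exprn_ge0 // ltW.
have lam_le : lam k <= 1 / 2.
  have dG : d * G ^+ k <= t.
    rewrite -ler_pdivlMr //; apply: le_trans Hd _.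
    by rewrite -!tau2 ler_pM2l.
  rewrite /lam ler_pdivrMr ?mulr_gt0 //.
  apply: le_trans (_ : d * G ^+ k <= _); last by rewrite /N; have := t0; lra.
  by rewrite mulrC ler_wpM2l // expn_le_G //; lra.
have R_le : R_ k.+1 <= R_ k.
  by rewrite -subr_ge0 R_gap !mulr_ge0 ?exprn_ge0.
have [J_step _ _] := J_rec.
apply: le_trans (J_step _ _ _ _ _ lam_ge0 lam_le R_le (tau0 k.+1) (tauS k)) _.
rewrite tau2 lam_gap.
have fc := f_chain HT.
have AL0 : 0 < A * L by apply: lt_le_trans ltr01 AL1.
have fk0 : 0 < f (t / G ^+ k.+1) by rewrite f_gt0 // divr_gt0.
have finv : (f (t / G ^+ k.+1))^-1 <= (A * L) ^+ k / f (t / G).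
  by rewrite ler_pdivlMr // mulrC ler_pdivrMr.
have Wk := w_ge k; have D65 := D_gt.
have AL_le : (A * L) ^+ k <= expR (w k).
  rewrite -[A * L]lnK ?posrE // -expRM_natr ler_expR.
  have lAL : ln (A * L) <= 2 * th * D.
    apply: le_trans logAL; rewrite ler_ln ?posrE -?mulrA ?(mulr_gt0 _ AL0) //.
    by have := ltW AL0; lra.
  have l1 := ler_wpM2r (ler0n R k) lAL.
  have l2 := ler_wpM2r (mulr_ge0 D0 (ler0n R k)) th_le.
  rewrite -(ler_pM2l B0); apply: le_trans Wk.
  have k0 : 0 <= D * k%:R by rewrite mulr_ge0.
  have e2 : B * (16 * B)^-1 = 1 / 16 by field; rewrite gt_eqF.
  have l3 := ler_wpM2l (ltW B0) l2.
  have l4 := ler_wpM2l (ltW B0) l1.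
  rewrite [X in _ <= X]mulrA e2 in l3.
  apply: le_trans l4 _.
  have -> : B * (2 * th * D * k%:R) = 2 * (B * (th * (D * k%:R))) by ring.
  by have := D0; lra.
have W1 : 1 <= w k.
  rewrite -(ler_pM2l B0) mulr1; apply: le_trans Wk.
  have k0 : 0 <= D * k%:R by rewrite mulr_ge0.
  by have := G0; lra.
have N16 : N / 16 = 32 by rewrite /N; field.
rewrite N16.
have wS : w k.+1 = 9 / 8 * w k by rewrite /w exprS; ring.
move: IH; rewrite /b wS => IH.
set F := (f (t / G))^-1 in finv IH *; set W := w k in IH W1 AL_le *.
have F0 : 0 < F by rewrite invr_gt0.
have X1 : J (R_ k.+1) (tau k.+1) + expR (- (32 * W)) / f (t / G ^+ k.+1) <=
    C * F * (expR (- (18 * W)) + expR (- (31 * W))).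
  rewrite [leRHS]mulrDr; apply: lerD.
    apply: le_trans IH _; rewrite le_eqVlt; apply/orP; left; apply/eqP.
    have -> : 16 * (9 / 8 * W) = 18 * W by field.
    by rewrite [_ * F]mulrC mulrA.
  apply: le_trans (ler_wpM2l (expR_ge0 _) finv) _.
  apply: le_trans (_ : F * expR (- (31 * W)) <= _); last first.
    by rewrite ler_wpM2r ?expR_ge0 // ler_peMl // ltW.
  have -> : - (31 * W) = - (32 * W) + W by ring.
  rewrite expRD mulrA [leRHS]mulrC ler_pM2r // ler_wpM2l ?expR_ge0 //.
have C0 : 0 < C by have := C1; lra.
have CF0 : 0 <= C * F by rewrite ltW // mulr_gt0.
apply: le_trans (_ : expR W * (C * F * (expR (- (18 * W)) + expR (- (31 * W)))) <= _).
  apply: le_trans (ler_wpM2l (expR_ge0 _) X1) _.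
  rewrite ler_wpM2r ?ler_expR ?lam_cost //.
  by rewrite mulr_ge0 // addr_ge0 ?expR_ge0.
have e1 : expR (- W) <= 1 / 2.
  rewrite expRN -div1r ler_pdivrMr ?expR_gt0 //.
  by have := expR_ge1Dx W; lra.
have -> : expR W * (C * F * (expR (- (18 * W)) + expR (- (31 * W)))) =
    C * F * expR (- (16 * W)) * (expR (- W) + expR (- (14 * W))).
  have E1 : expR (- (18 * W)) = expR (- (16 * W)) * expR (- W) * expR (- W).
    by rewrite -!expRD; congr expR; ring.
  have E2 : expR (- (31 * W)) = expR (- (16 * W)) * expR (- (14 * W)) * expR (- W).
    by rewrite -!expRD; congr expR; ring.
  have E3 : expR W * expR (- W) = 1 by rewrite -expRD subrr expR0.
  rewrite E1 E2 -mulrDl; set e := expR (- (16 * W)); set X := expR (- W) in E3 *.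
  transitivity (expR W * X * (C * F * e * (X + expR (- (14 * W))))); first by ring.
  by rewrite E3 mul1r.
have e14 : expR (- (14 * W)) <= expR (- W) by rewrite ler_expR; lra.
have -> : C * (expR (- (16 * W)) * F) = C * F * expR (- (16 * W)) by ring.
by rewrite ler_piMr ?mulr_ge0 ?expR_ge0 //; lra.
Qed.

Let chain K : T1 <= t / G ^+ K -> d <= t / G ^+ K ->
  J (R_ K) (tau K) <= C * b K -> J (R_ 0) (tau 0) <= C * b 0.
Proof.
elim: K => // K IH HT Hd HK.
have le : t / G ^+ K.+1 <= t / G ^+ K by rewrite -!tau2 ler_pM2l.
by apply: IH; [exact: le_trans le|exact: le_trans le|exact: chain_step].
Qed.

(** The last link goes directly to time 0.  Davies' bound has exponent
    D G^K / 16, which dominates the loss (A L)^K, the growth of f at the scale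
    t / G^K <= G max(T1, d), and 16 w K. *)
Let chain_base K : T1 <= t / G ^+ K -> d <= t / G ^+ K ->
  t / G ^+ K <= G * Num.max T1 d -> J (R_ K) (tau K) <= C * b K.
Proof.
move=> HT Hd HG.
have tK0 : 0 < t / G ^+ K by rewrite divr_gt0.
have RK : d / 4 <= R_ K <= d / 2.
  have p0 : 0 <= (3 / 4 : R) ^+ K by rewrite exprn_ge0.
  have p1 : (3 / 4 : R) ^+ K <= 1 by rewrite exprn_ile1 //; lra.
  have -> : R_ K = d / 4 + d / 4 * (3 / 4) ^+ K by rewrite /R_; field.
  have dp : 0 <= d / 4 by rewrite divr_ge0.
  have := mulr_ge0 dp p0; have := ler_wpM2l dp p1; rewrite mulr1 => h1 h2.
  by apply/andP; split; lra.
move: RK => /andP[RK1 RK2].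
have X1 : J (R_ K) (tau K) <= expR (- (D * G ^+ K / 16)).
  apply: le_trans (davies _ _ (tau0 K)) _.
  - by apply: le_trans RK1; rewrite divr_ge0.
  - by rewrite tau2; apply: le_trans RK2 _; have := d_gt0; lra.
  rewrite ler_expR lerN2.
  have -> : D * G ^+ K / 16 = (d / 4) ^+ 2 / (4 * tau K).
    rewrite /D /tau; set Y := G ^+ K; have Y0 : 0 < Y by exact: Gk0.
    by field; rewrite !gt_eqF.
  have dp : 0 <= d / 4 by rewrite divr_ge0.
  apply: ler_wpM2r; first by rewrite invr_ge0 mulr_ge0 // ltW.
  by rewrite lerXn2r ?nnegrE // (le_trans dp).
apply: le_trans X1 _.
rewrite /b mulrA ler_pdivlMr // mulrC.
have G1 : 1 <= G by have := G2; lra.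
have AL0 : 0 < A * L by apply: lt_le_trans ltr01 AL1.
have f1 : f (t / G) <= (A * L) ^+ K * f (t / G ^+ K).
  case: K HT {Hd HG tK0 RK1 RK2} => [|K] HT.
    rewrite expr0 mul1r expr0 divr1; apply: f_mono; first exact: ltW.
    by rewrite ler_pdivrMr // ler_peMr // ltW.
  apply: le_trans (f_chain HT) _.
  have fp : 0 <= f (t / G ^+ K.+1) by rewrite ltW // f_gt0 // divr_gt0.
  have p0 : 0 <= (A * L) ^+ K by rewrite exprn_ge0 // ltW.
  by rewrite ler_wpM2r // exprS ler_peMl.
have f2 : f (t / G ^+ K) <= A * (t / G ^+ K) `^ eps.
  apply: f_growth => //; rewrite le_max; apply/orP; right.
  by rewrite ler_pdivrMr // ler_peMr ?exprn_ege1 // ltW.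
have GK1 : 1 <= G ^+ K by rewrite exprn_ege1.
have DGK : 0 <= D * G ^+ K by rewrite mulr_ge0 // ltW.
have GD : G <= D by apply: le_trans D_gt; have := B0; lra.
have lnG : 0 <= ln G by rewrite ln_ge0.
have logM : 0 <= ln M by rewrite ln_ge0.
have C20 : 0 <= C2 by rewrite mulr_ge0.
have f3 : (t / G ^+ K) `^ eps <= expR (eps * ln G + C2 + D * G ^+ K / 64).
  apply: powR_le_expR; first exact: ltW; last first.
    by rewrite addr_ge0 ?divr_ge0 // addr_ge0 // mulr_ge0.
  move=> _.
  have T0 : 0 < Num.max T1 d by rewrite lt_max d_gt0 orbT.
  apply: le_trans (_ : eps * (ln G + ln (Num.max T1 d)) <= _).
    apply: ler_wpM2l => //; rewrite -lnM ?posrE //.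
    have GT0 : 0 < G * Num.max T1 d by rewrite mulr_gt0.
    by rewrite ler_ln ?posrE.
  rewrite mulrDr -addrA lerD2l.
  case: (leP T1 d) => T1d.
    (* t / G^K <= G d, hence D G^K >= d / (2 G), which beats eps ln d *)
    have M0 : 0 < M by apply: lt_le_trans ltr01 M1.
    have l1 : ln d <= d / M + ln M.
      have -> : ln d = ln (d / M) + ln M by rewrite ln_div ?posrE // subrK.
      by rewrite lerD2r ltW // ln_sublinear // divr_gt0.
    have l2 : eps * ln d <= eps * (d / M) + C2.
      by rewrite /C2 -mulrDr ler_wpM2l.
    apply: le_trans l2 _; rewrite [leLHS]addrC lerD2l.
    have l3 : eps * (d / M) <= d / (128 * G).
      have -> : eps * (d / M) = eps / (eps + 1) * (d / (128 * G)).
        rewrite /M; field; rewrite !gt_eqF //; have := eps0; lra.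
      rewrite ler_piMl ?divr_ge0 ?mulr_ge0 //; first exact: ltW.
      rewrite ler_pdivrMr; have := eps0; lra.
    apply: le_trans l3 _.
    move: HG; rewrite max_r // => HG.
    rewrite ler_pdivrMr ?mulr_gt0 //.
    have -> : D * G ^+ K / 64 * (128 * G) = d * (d * G * G ^+ K / t).
      by rewrite /D; field; rewrite gt_eqF.
    rewrite ler_peMr // ler_pdivlMr // mul1r.
    by rewrite -ler_pdivrMr // [leRHS]mulrC.
  (* t / G^K <= G T1, and eps ln T1 <= t / (1024 T1) <= G^(K+1) / 1024 *)
  apply: le_trans (_ : D * G ^+ K / 64 <= _); last by rewrite lerDr.
  have T1p : 0 < T1 by apply: lt_trans T1d.
  move: HG; rewrite max_l ?(ltW T1d) // => HG.
  have tT : t / T1 <= G ^+ K * D.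
    rewrite ler_pdivrMr //; move: HG; rewrite ler_pdivrMr // => /le_trans; apply.
    have -> : G * T1 * G ^+ K = G ^+ K * G * T1 by ring.
    apply: ler_wpM2r; first exact: ltW.
    by apply: ler_wpM2l => //; exact: ltW.
  have [T11|T11] := leP T1 1.
    apply: le_trans (_ : 0 <= _); last by rewrite divr_ge0.
    by apply: mulr_ge0_le0 => //; exact: ln_le0.
  move: T1t; rewrite max_l; last exact: ltW.
  have -> : 2 ^+ 10 * eps * T1 * ln T1 = 1024 * (eps * ln T1) * T1 by ring.
  rewrite -ler_pdivlMr // => H.
  have := le_trans H tT; rewrite [G ^+ K * D]mulrC; set X := D * _; set Y := eps * _ => h1.
  have h0 : 0 <= X by [].
  lra.
have f4 : f (t / G) <= expR (K%:R * ln (A * L)) * (A * expR (eps * ln G + C2 + D * G ^+ K / 64)).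
  apply: le_trans f1 _; rewrite expRM_natl lnK ?posrE //.
  apply: ler_wpM2l; first by rewrite exprn_ge0 // ltW.
  by apply: le_trans f2 _; rewrite ler_pM2l.
have B1024 : 1024 <= B by rewrite /B /N; lra.
set X := D * G ^+ K in DGK f3 f4 *.
have w16 : 16 * w K <= X / 64.
  have : (9 / 8) ^+ K <= G ^+ K by rewrite expn_le_G //; lra.
  move=> /(ler_wpM2r D0); rewrite [G ^+ K * D]mulrC -/X => h1.
  have -> : w K = (9 / 8) ^+ K * D * B^-1 by rewrite /w.
  have Bi : B^-1 <= 1 / 1024 by exact: inv_le_1024.
  have h2 : (9 / 8) ^+ K * D * B^-1 <= X * (1 / 1024).
    apply: ler_pM => //; first by rewrite mulr_ge0 ?exprn_ge0.
    by rewrite invr_ge0 ltW.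
  lra.
have KAL : K%:R * ln (A * L) <= X / 64.
  have lAL : ln (A * L) <= 2 * th * D.
    apply: le_trans logAL; rewrite ler_ln ?posrE -?mulrA ?(mulr_gt0 _ AL0) //.
    by have := ltW AL0; lra.
  apply: le_trans (ler_wpM2l (ler0n R K) lAL) _.
  have KG : K%:R <= G ^+ K.
    apply: le_trans (_ : 2 ^+ K <= _); last by rewrite expn_le_G.
    by rewrite -natrX ler_nat ltnW // ltn_expl.
  have th64 : 2 * th <= 1 / 64.
    have Bi : (16 * B)^-1 <= 1 / 1024.
      have B16 : 1024 <= 16 * B by have := ltW B0; lra.
      exact: inv_le_1024.
    by have := th_le; lra.
  rewrite mulrC -mulrA; have h1 := ler_wpM2l D0 KG; rewrite -/X in h1.
  have h0 : 0 <= D * K%:R by rewrite mulr_ge0.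
  by have := ler_wpM2r h0 th64; lra.
apply: le_trans (ler_wpM2r (expR_ge0 _) f4) _.
apply: le_trans (_ : A * expR (eps * ln G + C2) * expR (- (16 * w K)) <= _).
  set e1 := eps * ln G + C2; set k1 := K%:R * ln (A * L) in KAL *.
  have -> : expR k1 * (A * expR (e1 + X / 64)) * expR (- (X / 16)) =
    A * expR (k1 + (e1 + X / 64) - X / 16).
    have -> : expR (k1 + (e1 + X / 64) - X / 16) =
        expR k1 * expR (e1 + X / 64) * expR (- (X / 16)) by rewrite -!expRD.
    by ring.
  rewrite -[leRHS]mulrA -expRD ler_pM2l // ler_expR.
  by lra.
rewrite ler_wpM2r ?expR_ge0 // /C.
have := expR_gt0 (th * K0); have := mulr_gt0 A0 (expR_gt0 1).
by lra.
Qed.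

Lemma far_from_diagonal : J (d / 2) (t / 2) <= C / f (t / G) * expR (- (th * D)).
Proof.
have T0 : 0 < Num.max T1 d by rewrite lt_max d_gt0 orbT.
have Tt : Num.max T1 d <= t by rewrite ge_max T1_le_t dt.
have [K [K1 K2]] := exists_last_scale G2 T0 Tt.
have HT : T1 <= t / G ^+ K by apply: le_trans K1; rewrite le_max lexx.
have Hd : d <= t / G ^+ K by apply: le_trans K1; rewrite le_max lexx orbT.
have := chain HT Hd (chain_base HT Hd K2).
have -> : R_ 0 = d / 2 by rewrite /R_ expr0; field.
have -> : tau 0 = t / 2 by rewrite /tau expr0 mulr1.
move=> /le_trans; apply; rewrite /b mulrCA [leRHS]mulrAC [leLHS]mulrC mulrAC.
have C0 : 0 <= C / f (t / G) by rewrite divr_ge0 // ltW //; have := C1; lra.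
apply: ler_wpM2l => //; rewrite ler_expR lerN2 /w expr0 mul1r.
have -> : 16 * (D / B) = 16 / B * D by ring.
rewrite ler_wpM2r //; apply: le_trans th_le _.
rewrite -[leLHS]mul1r invfM mulrA ler_wpM2r ?invr_ge0 //; first exact: ltW.
lra.
Qed.

End Chaining.

Lemma tail_constant_ge1 : 1 <= tail_constant A G eps.
Proof. exact: C1. Qed.

Lemma gaussian_tail_scaled : J (d / 2) (t / 2) <=
  tail_constant A G eps / f (t / G) * expR (- (2 * (10 ^- 7 * (d ^+ 2 / t)))).
Proof.
rewrite -[tail_constant _ _ _]/C.
have -> : 2 * (10 ^- 7 * (d ^+ 2 / t)) = th * D.
  by rewrite /th /D; set X := 10 ^- 7; field; rewrite gt_eqF.
have [|H] := leP (th * D) (ln L + th * K0); first exact: near_diagonal.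
have K00 : 0 <= K0.
  by rewrite /K0 addr_ge0 ?divr_ge0 ?addr_ge0 //; exact: ltW.
have lnL0 : 0 <= ln L by rewrite ln_ge0.
have thK : 0 <= th * K0 by rewrite mulr_ge0 // ltW.
have [T1t'|T1t'] := leP T1 t.
  apply: far_from_diagonal => //; last by lra.
  by rewrite -(ltr_pM2l th0); lra.
apply: before_T1 => //.
have t4 : th <= 4^-1.
  apply: le_trans th_le _; rewrite lef_pV2 ?posrE ?mulr_gt0 //.
  have B1 : 1 <= B by rewrite /B /N; lra.
  lra.
by rewrite mulrC ler_wpM2l.
Qed.

End Iteration.

Section RegularityTransfer.
Variable R : realType.

(** The ratio over gamma^n is a product of n ratios over gamma. *)
Lemma regular_on_expn (A gamma : R) (f : R -> R) (T1 : R) (T2 : \bar R) (n : nat)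
    (s t : R) : 0 <= A -> 1 < gamma -> nneg_pos_function f ->
  regular_on A gamma f T1 T2 ->
  T1 <= s -> 0 < s -> s < t -> ((gamma ^+ n * t)%:E < T2)%E ->
  f (gamma ^+ n * s) / f s <= A ^+ n * (f (gamma ^+ n * t) / f t).
Proof.
move=> A0 gamma1 [_ f_gt0] [_ f_reg] T1s s0 st.
have t0 : 0 < t by apply: lt_trans st.
have g0 : 0 < gamma by lra.
elim: n => [|n IH] tT2; first by rewrite !expr0 !mul1r !divff ?gt_eqF ?f_gt0.
have gn0 : 0 < gamma ^+ n by rewrite exprn_gt0.
have gn1 : 1 <= gamma ^+ n by rewrite exprn_ege1 // ltW.
have E r : gamma ^+ n.+1 * r = gamma * (gamma ^+ n * r) by rewrite exprS mulrA.
rewrite !E in tT2 *.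
have fs : 0 < f (gamma ^+ n * s) by rewrite f_gt0 // mulr_gt0.
have ft : 0 < f (gamma ^+ n * t) by rewrite f_gt0 // mulr_gt0.
have step : f (gamma * (gamma ^+ n * s)) / f (gamma ^+ n * s) <=
    A * (f (gamma * (gamma ^+ n * t)) / f (gamma ^+ n * t)).
  have := f_reg (gamma ^+ n * s) (gamma ^+ n * t).
  rewrite gt_eqF //; apply.
  - by apply: le_trans T1s _; rewrite ler_peMl // ltW.
  - by rewrite ltr_pM2l.
  - by rewrite lte_pdivlMl.
have tT2' : ((gamma ^+ n * t)%:E < T2)%E.
  apply: le_lt_trans tT2; rewrite lee_fin ler_peMl // ltW //.
  exact: mulr_gt0.
have {}IH := IH tT2'.
have split_ratio r : 0 < f (gamma ^+ n * r) ->
    f (gamma * (gamma ^+ n * r)) / f r =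
    f (gamma * (gamma ^+ n * r)) / f (gamma ^+ n * r) * (f (gamma ^+ n * r) / f r).
  by move=> h; rewrite [RHS]mulrA divfK // gt_eqF.
rewrite !split_ratio // exprS.
set x := _ / f (gamma ^+ n * s) in step *; set y := f (gamma ^+ n * s) / f s in IH *.
set x' := _ / f (gamma ^+ n * t) in step *; set y' := f (gamma ^+ n * t) / f t in IH *.
have -> : A * A ^+ n * (x' * y') = (A * x') * (A ^+ n * y') by ring.
by apply: ler_pM => //; apply: divr_ge0; apply: ltW => //; apply: f_gt0 => //;
  rewrite ?mulr_gt0 // mulr_gt0.
Qed.

Definition gaussian_tails (A gamma eps C T1 : R) (T2 : \bar R) : Prop :=
  forall (f : R -> R) (J : R -> R -> R) (t d : R),
  nneg_pos_function f -> regular_on A gamma f T1 T2 ->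
  (forall s, T1 <= s -> (s%:E < T2)%E -> f s <= A * s `^ eps) ->
  tail_recursion f J ->
  2 ^+ 10 * eps * T1 * ln (Num.max T1 1) <= t -> 0 <= d -> d <= t ->
  (t%:E < T2)%E -> 0 < t ->
  J (d / 2) (t / 2) <=
    C / f (t / (2 * gamma)) * expR (- (2 * (10 ^- 7 * (d ^+ 2 / t)))).

(** Scales are divided by a power of gamma between 2 and 2 gamma.  It is at
    least 2, so that the constant in the exponent does not depend on gamma; it
    is at most 2 gamma, so that the largest scale reached by f is at least
    t / (2 gamma). *)
Lemma gaussian_tail (A gamma eps : R) : 1 <= A -> 1 < gamma -> 0 <= eps ->
  exists2 C : R, 0 < C & forall (T1 : R) (T2 : \bar R),
  0 <= T1 -> (T1%:E < T2)%E -> gaussian_tails A gamma eps C T1 T2.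
Proof.
move=> A1 gamma1 eps0.
have [n [n0 G2 G2g]] := exists_expn_between gamma1.
have A0 : 0 <= A by lra.
have g0 : 0 < gamma by lra.
set G := gamma ^+ n in G2 G2g.
have G0 : 0 < G by lra.
have An1 : 1 <= A ^+ n by rewrite exprn_ege1.
have AAn : A <= A ^+ n by rewrite -(prednK n0) exprS ler_peMr // exprn_ege1.
have {}G2 := ltW G2.
have C1 : 1 <= tail_constant (A ^+ n) G eps by exact: tail_constant_ge1.
exists (tail_constant (A ^+ n) G eps); first by lra.
move=> T1 T2 T10 T1T2 f J t d fpos freg fgrow Jrec T1t d0 dt tT2 t0.
have fmono := freg.1.
have f_gt0 := fpos.2.
apply: le_trans (_ : tail_constant (A ^+ n) G eps / f (t / G) *
    expR (- (2 * (10 ^- 7 * (d ^+ 2 / t)))) <= _); last first.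
  rewrite ler_wpM2r ?expR_ge0 // ler_pM2l; last by lra.
  rewrite lef_pV2 ?posrE ?f_gt0 ?divr_gt0 ?mulr_gt0 //.
  apply: fmono; first by rewrite divr_ge0 // ?mulr_ge0 // ltW.
  by rewrite ler_pM2l // lef_pV2 ?posrE ?mulr_gt0.
apply: (@gaussian_tail_scaled R (A ^+ n) G eps An1 G2 eps0 f J T1 t d) => //.
- move=> s T1s s0 sG.
  have E : t = G * (t / G) by rewrite mulrCA divff ?mulr1 // gt_eqF.
  rewrite [in f t]E; apply: (regular_on_expn A0 gamma1 fpos freg T1s s0 sG).
  by rewrite -/G -E.
- move=> s T1s sM; apply: le_trans (fgrow s T1s _) _.
    by apply: le_lt_trans (_ : (Num.max T1 t)%:E < T2)%E; rewrite ?lee_fin // maxEle; case: ifP.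
  by rewrite ler_wpM2r // powR_ge0.
Qed.

End RegularityTransfer.

(** * Rates and weights of a locally finite graph *)

Definition neighbours (V : choiceType) (E : rel V) (v : V) : {fset V} :=
  fset_set [set y | E v y].

Section Graph.
Context (R : realType) (V : choiceType) (E : rel V) (mu : V -> V -> R)
  (nu : V -> R) (dnu : V -> V -> R).
Hypothesis graphE : locally_finite_connected_graph E.
Hypothesis weight : edge_weight E mu.
Hypothesis nu_gt0 : forall x, 0 < nu x.

Let nbr := neighbours E.

Let in_nbr v y : (y \in nbr v) = E v y.
Proof.
case: graphE => _ fin _; rewrite /nbr /neighbours in_fset_set //.
by apply/idP/idP => [/set_mem|/mem_set].
Qed.

Let mu_ge0 v y : 0 <= mu v y.
Proof.
case: weight => _ pos zero; have [/pos/ltW //|/zero ->] := boolP (E v y); by [].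
Qed.

Let mu_supp v y : y \notin nbr v -> mu v y = 0.
Proof. by rewrite in_nbr; case: weight => _ _; apply. Qed.

(** This is how a finite set of vertices sees only part of a sum over
    neighbours: the missing part is the rate of killing. *)
Lemma sum_fin_le_fsum (I : finType) (iota : I -> V) (A : {fset V}) (g : V -> R) :
  injective iota -> (forall z, 0 <= g z) -> (forall z, z \notin A -> g z = 0) ->
  \sum_i g (iota i) <= \sum_(z \in [set: V]) g z.
Proof.
move=> inj g0 gA; rewrite (@fsbigTE _ _ _ _ A) //.
rewrite (_ : \sum_i _ = \sum_(z <- map iota (index_enum I)) g z); last first.
  by rewrite big_map.
set s := map iota (index_enum I).
have us : uniq s by rewrite map_inj_uniq ?index_enum_uniq.
have -> : \sum_(z <- s) g z = \sum_(z <- [seq z <- s | z \in A]) g z.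
  rewrite big_filter [RHS]big_mkcond; apply: eq_bigr => z _.
  by case: ifPn => // /gA.
rewrite (perm_big [seq z <- A | z \in s]); last first.
  apply: uniq_perm; rewrite ?filter_uniq ?fset_uniq //.
  by move=> z; rewrite !mem_filter andbC.
rewrite big_filter big_mkcond /=; apply: ler_sum => z _.
by case: ifP.
Qed.

Lemma fsum_single (g : V -> R) (y : V) : (forall z, z != y -> g z = 0) ->
  \sum_(z \in [set: V]) g z = g y.
Proof.
move=> gy; rewrite (@fsbigTE _ _ _ _ [fset y]%fset); last first.
  by move=> z; rewrite in_fset1; exact: gy.
by rewrite big_seq_fset1.
Qed.

Lemma Qmatrix_neq x y : x != y -> Qmatrix mu nu x y = (nu x)^-1 * mu x y.
Proof.
move=> xy; rewrite /Qmatrix /generator (@fsum_single _ y).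
  by rewrite eqxx (negbTE xy) subr0 mul1r.
by move=> z zy; rewrite (negbTE zy) (negbTE xy) subrr mul0r.
Qed.

Lemma jump_rateE x :
  nu x * jump_rate mu nu x = \sum_(z \in [set: V]) ((z != x)%:R * mu x z).
Proof.
rewrite /jump_rate /Qmatrix /generator mulrN mulrA divff ?mul1r ?gt_eqF //.
rewrite !(@fsbigTE _ _ _ _ (nbr x)); first last.
- by move=> z /mu_supp ->; rewrite mulr0.
- by move=> z /mu_supp ->; rewrite mulr0.
rewrite -sumrN; apply: eq_bigr => z _; rewrite eqxx.
by case: eqP => _ /=; ring.
Qed.

Lemma jump_rate_ge_fin (I : finType) (iota : I -> V) x : injective iota ->
  \sum_i (iota i != x)%:R * mu x (iota i) <= nu x * jump_rate mu nu x.
Proof.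
move=> inj; rewrite jump_rateE.
apply: (@sum_fin_le_fsum I iota (nbr x) (fun z => (z != x)%:R * mu x z)) => // z.
  by rewrite mulr_ge0.
by move=> /mu_supp ->; rewrite mulr0.
Qed.

Lemma jump_rate_ge0 x : 0 <= jump_rate mu nu x.
Proof.
have := @jump_rate_ge_fin unit (fun=> x) x (fun 'tt 'tt _ => erefl).
rewrite (bigD1 tt) //= big1 ?addr0; last by case.
by rewrite eqxx mul0r pmulr_rge0.
Qed.

(** Both sides vanish for y = x: loops do not change the position, and an
    absorbing x has rate 0. *)
Lemma rate_mul_prob x y :
  jump_rate mu nu x * jump_prob mu nu x y = (y != x)%:R * ((nu x)^-1 * mu x y).
Proof.
rewrite /jump_prob; have [q0|q0] := eqVneq (jump_rate mu nu x) 0.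
  rewrite q0 mul0r; have [->|yx] := eqVneq y x; first by rewrite mul0r.
  have := @jump_rate_ge_fin unit (fun=> y) x (fun 'tt 'tt _ => erefl).
  rewrite q0 mulr0 (bigD1 tt) //= big1 ?addr0; last by case.
  rewrite yx !mul1r => mu0; have -> : mu x y = 0 by apply/eqP; rewrite eq_le mu0 mu_ge0.
  by rewrite mulr0.
have [->|yx] := eqVneq y x; first by rewrite mulr0 mul0r.
by rewrite mulrCA divff // mulr1 mul1r Qmatrix_neq // eq_sym.
Qed.

Lemma jump_prob_ge0 x y : 0 <= jump_prob mu nu x y.
Proof.
rewrite /jump_prob; case: ifP => // _; case: ifPn => // yx.
rewrite divr_ge0 ?jump_rate_ge0 // Qmatrix_neq 1?eq_sym // mulr_ge0 //.
by rewrite invr_ge0 ltW.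
Qed.

Lemma adapted_fin (I : finType) (iota : I -> V) x : injective iota ->
  adapted_distance E mu nu dnu ->
  \sum_i mu x (iota i) * dnu x (iota i) ^+ 2 <= nu x.
Proof.
move=> inj [_ ad _].
have := ad x; rewrite ler_pdivrMl // mulr1; apply: le_trans.
under eq_bigr do rewrite mulrC.
apply: (@sum_fin_le_fsum I iota (nbr x) (fun z => dnu x z ^+ 2 * mu x z)) => // z.
  by rewrite mulr_ge0 ?sqr_ge0.
by move=> /mu_supp ->; rewrite mulr0.
Qed.

End Graph.

(** * The walk on the graph *)

Section WalkOnGraph.
Context (R : realType) (V : choiceType) (E : rel V) (mu : V -> V -> R)
  (nu : V -> R) (dnu : V -> V -> R) (disp : measure_display)
  (Omega : measurableType disp) (P : V -> probability Omega R)
  (Y : nat -> Omega -> V) (tau : nat -> Omega -> \bar R).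
Hypothesis graphE : locally_finite_connected_graph E.
Hypothesis weight : edge_weight E mu.
Hypothesis nu_gt0 : forall x, 0 < nu x.
Hypothesis adapted : adapted_distance E mu nu dnu.
Hypothesis JC : jump_chain_holding_times mu nu P Y tau.

Let Y_meas n y : measurable [set w | Y n w = y]. Proof. by case: JC. Qed.
Let tau_meas n : measurable_fun setT (tau n). Proof. by case: JC. Qed.
Let tau_gt0 n w : (0 < tau n w)%E. Proof. by case: JC. Qed.

Definition at_position (y : V) (t : R) : set Omega :=
  [set w | exists n, (jump_time tau n w <= t%:E < jump_time tau n.+1 w)%E /\ Y n w = y].

Lemma measurable_at_position y t : measurable (at_position y t).
Proof.
rewrite (_ : at_position y t = \bigcup_n ([set w | (jump_time tau n w <= t%:E)%E] `&`
    ~` [set w | (jump_time tau n.+1 w <= t%:E)%E] `&` [set w | Y n w = y])).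
  apply: bigcupT_measurable => n; apply: measurableI => //.
  by apply: measurableI; [|apply: measurableC]; exact: measurable_jump_time.
apply/seteqP; split => w.
  move=> [n [/andP[h1 h2] h3]]; exists n => //; split => //; split => //.
  by apply/negP; rewrite -ltNge.
move=> [n _ [[h1 h2] h3]]; exists n; split => //; apply/andP; split => //.
by rewrite ltNge; apply/negP.
Qed.

Section FinitePiece.
Variables (I : finType) (iota : I -> V).
Hypothesis iota_inj : injective iota.

Let nuI i := nu (iota i).
Let m i j := mu (iota i) (iota j).
(* Killing at i comes from the edges that leave I. *)
Let k i := nuI i * jump_rate mu nu (iota i) - \sum_j (iota j != iota i)%:R * m i j.
Let d i j := dnu (iota i) (iota j).
Let u a t i := pr (P (iota a)) (killed_position Y tau iota i t) / nuI i.

Let nuI_gt0 i : 0 < nuI i. Proof. exact: nu_gt0. Qed.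
Let m_sym i j : m i j = m j i. Proof. by case: weight => sym _ _; exact: sym. Qed.
Let m_ge0 i j : 0 <= m i j.
Proof.
case: weight => _ pos zero; rewrite /m.
by have [/pos/ltW //|/zero ->] := boolP (E (iota i) (iota j)).
Qed.
Let k_ge0 i : 0 <= k i.
Proof. by rewrite subr_ge0; exact: (jump_rate_ge_fin graphE weight nu_gt0). Qed.

Let mkilled i t : measurable (killed_position Y tau iota i t).
Proof. exact: (measurable_killed_position Y_meas tau_meas tau_gt0). Qed.

Lemma killed_position_sub i t :
  killed_position Y tau iota i t `<=` at_position (iota i) t.
Proof. by move=> w [n [_ H1 H2]]; exists n. Qed.

(** Divided by nu, the forward equation is the heat equation: detailed balance
    moves the factor nu from the state that is left to the one entered. *)
Let u_heat_kernel a : heat_kernel nuI m k (\sum_i (nuI i)^-1) a (u a).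
Proof.
have [_ _ _ law] := JC.
have qg := jump_rate_ge0 graphE weight nu_gt0.
have jg := jump_prob_ge0 graphE weight nu_gt0.
split; last first.
  move=> z; rewrite /u (killed_position0 tau_gt0 (law (iota a))).
  by rewrite (inj_eq iota_inj); case: eqVneq => [->|_] //; rewrite !mul0r.
split.
  move=> t i _; rewrite /u divr_ge0 ?pr_ge0 ?(ltW (nuI_gt0 _)) //=.
  apply: le_trans (_ : (nuI i)^-1 <= _).
    by rewrite ler_piMl ?invr_ge0 ?(ltW (nuI_gt0 _)) //; exact: pr_le1.
  rewrite (bigD1 i) //= lerDl sumr_ge0 // => j _.
  by rewrite invr_ge0 ltW.
have [C [h0 [h00 HC]]] := killed_position_flow Y_meas tau_meas tau_gt0 jg
  (law (iota a)) iota_inj qg.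
exists (\sum_i `|C| / nuI i), h0; split => // t h i t0 h_ge hh.
have := HC t h i t0 h_ge hh.
pose p j s := pr (P (iota a)) (killed_position Y tau iota j s).
rewrite -/(p i (t + h)) -/(p i t); under eq_bigr do rewrite -/(p _ t).
set G := \sum_j _ - _ => H.
have GE : heat_op nuI m k (u a t) i = G / nuI i.
  rewrite /heat_op mulrC; congr (_ / _).
  rewrite /G [X in _ = X - _](eq_bigr (fun j => (iota j != iota i)%:R * m i j * u a t j)); last first.
    move=> j _; rewrite (rate_mul_prob graphE weight nu_gt0) /u -/(p j t) eq_sym /m.
    have [<- _ _] := weight; rewrite -/(nuI j); field.
    by rewrite gt_eqF.
  have uE : p i t = nuI i * u a t i.
    by rewrite /u -/(p i t) mulrCA divff ?mulr1 // gt_eqF.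
  have -> : \sum_j m i j * (u a t j - u a t i) =
      \sum_j (iota j != iota i)%:R * m i j * u a t j -
      (\sum_j (iota j != iota i)%:R * m i j) * u a t i.
    rewrite mulr_suml -sumrB; apply: eq_bigr => j _.
    rewrite (inj_eq iota_inj); case: eqVneq => [->|_] /=; first by rewrite subrr; ring.
    by ring.
  by rewrite uE /k; ring.
have -> : u a (t + h) i - u a t i - h * heat_op nuI m k (u a t) i =
    (p i (t + h) - p i t - h * G) / nuI i.
  by rewrite GE /u -/(p i (t + h)) -/(p i t); ring.
rewrite normrM normfV (gtr0_norm (nuI_gt0 i)).
apply: le_trans (_ : `|C| * h ^+ 2 / nuI i <= _).
  rewrite ler_wpM2r ?invr_ge0 ?(ltW (nuI_gt0 _)) //; apply: le_trans H _.
  by rewrite ler_wpM2r ?sqr_ge0 // ler_norm.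
rewrite mulrAC ler_wpM2r ?sqr_ge0 // (bigD1 i) //= lerDl sumr_ge0 // => j _.
by rewrite divr_ge0 // ltW.
Qed.

Let d_ge0 i j : 0 <= d i j. Proof. by case: adapted => -[h *]; exact: h. Qed.
Let d_sym i j : d i j = d j i. Proof. by case: adapted => -[_ _ h *]; exact: h. Qed.
Let d_le1 i j : 0 < m i j -> d i j <= 1.
Proof.
case: adapted => _ _ le1; case: weight => _ _ zero; rewrite /m /d.
have [/le1 //|/zero ->] := boolP (E (iota i) (iota j)); by rewrite ltxx.
Qed.
Let d_adapted i : \sum_j m i j * d i j ^+ 2 <= nuI i.
Proof. exact: (adapted_fin graphE weight nu_gt0 _ iota_inj adapted). Qed.
Let d_refl i : d i i = 0.
Proof. by case: adapted => -[_ d0 _ _] _ _; apply/d0. Qed.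
Let d_triangle i j l : d i l <= d i j + d j l.
Proof. by case: adapted => -[_ _ _ h] *; exact: h. Qed.

(** Killing only decreases return probabilities. *)
Let on_diagonal a (f : R -> R) (s : R) : 0 < s -> nneg_pos_function f ->
  (forall t, 0 <= t -> (P (iota a) (at_position (iota a) t) <= (f t)%:E^-1)%E) ->
  nuI a * u a s a <= (f s)^-1.
Proof.
move=> s0 [_ f_gt0] H.
have -> : nuI a * u a s a = pr (P (iota a)) (killed_position Y tau iota a s).
  by rewrite /u mulrCA divff ?mulr1 // gt_eqF.
apply: le_trans (pr_le _ (mkilled a s) (measurable_at_position _ _)
  (@killed_position_sub a s)) _.
rewrite -lee_fin -prE; last exact: measurable_at_position.
apply: le_trans (H s (ltW s0)) _.
by rewrite inver gt_eqF // f_gt0.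
Qed.

(** The tails at a and b have square roots p and the diagonal terms square roots
    q, with p = sqrt C exp (- x) q: both products in [heat_kernel_offdiag] equal
    sqrt C exp (- x) times the product of the two q. *)
Lemma killed_walk_gaussian (A gamma eps C : R) (T1 : R) (T2 : \bar R)
    (a b : I) (f1 f2 : R -> R) (t : R) :
  1 < gamma -> 0 < C ->
  gaussian_tails A gamma eps C T1 T2 ->
  nneg_pos_function f1 -> nneg_pos_function f2 ->
  (forall t, 0 <= t -> (P (iota a) (at_position (iota a) t) <= (f1 t)%:E^-1)%E) ->
  (forall t, 0 <= t -> (P (iota b) (at_position (iota b) t) <= (f2 t)%:E^-1)%E) ->
  regular_on A gamma f1 T1 T2 -> regular_on A gamma f2 T1 T2 ->
  (forall t, T1 <= t -> (t%:E < T2)%E -> f1 t <= A * t `^ eps) ->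
  (forall t, T1 <= t -> (t%:E < T2)%E -> f2 t <= A * t `^ eps) ->
  Num.max (2 ^+ 10 * eps * T1 * ln (Num.max T1 1)) (dnu (iota a) (iota b)) <= t ->
  (t%:E < T2)%E -> 0 < t ->
  pr (P (iota a)) (killed_position Y tau iota b t) <=
   2 * Num.sqrt C * Num.sqrt (nu (iota b) / nu (iota a))
    / Num.sqrt (f1 (t / (2 * gamma)) * f2 (t / (2 * gamma)))
    * expR (- (10 ^- 7 * (dnu (iota a) (iota b) ^+ 2 / t))).
Proof.
rewrite -/(nuI a) -/(nuI b) -/(d a b).
move=> gamma1 C0 tail f1p f2p diag1 diag2 reg1 reg2 grow1 grow2.
rewrite ge_max => /andP[T1t dt] tT2 t0.
have tailJ (c : I) (f : R -> R) (e : R) : nneg_pos_function f ->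
    (forall t, 0 <= t -> (P (iota c) (at_position (iota c) t) <= (f t)%:E^-1)%E) ->
    regular_on A gamma f T1 T2 ->
    (forall t, T1 <= t -> (t%:E < T2)%E -> f t <= A * t `^ eps) ->
    0 <= e -> e <= t ->
    tail_mass nuI d c (u c) (e / 2) (t / 2) <=
      C / f (t / (2 * gamma)) * expR (- (2 * (10 ^- 7 * (e ^+ 2 / t)))).
  move=> fp diag reg grow e0 et; apply: (tail f _ t e) => //; split.
  - move=> r r' s s' lam lam0 lam12 rr s'0 ss.
    apply: le_trans (tail_mass_step nuI_gt0 m_sym m_ge0 k_ge0 d_ge0 d_sym d_le1
      d_adapted d_triangle (u_heat_kernel c) lam0 lam12 rr (ltW s'0) ss) _.
    rewrite ler_wpM2l ?expR_ge0 // lerD2l ler_wpM2l ?expR_ge0 //.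
    by apply: on_diagonal => //; rewrite mulr_gt0.
  - move=> r s lam lam0 lam12 s0.
    exact: (tail_mass_davies nuI_gt0 m_sym m_ge0 k_ge0 d_ge0 d_sym d_le1
      d_adapted d_refl d_triangle r (u_heat_kernel c) lam0 lam12 s0).
  - move=> r s s0.
    apply: le_trans (tail_mass_le nuI_gt0 m_sym m_ge0 k_ge0 d r (u_heat_kernel c) (ltW s0)) _.
    by apply: on_diagonal => //; rewrite mulr_gt0.
set s := t / (2 * gamma); set x := 10 ^- 7 * (d a b ^+ 2 / t).
have g0 : 0 < gamma by lra.
have s0 : 0 < s by rewrite divr_gt0 ?mulr_gt0.
have st : s <= t.
  by rewrite /s ler_pdivrMr ?mulr_gt0 // ler_peMr ?(ltW t0) //; lra.
have F1 : 0 < f1 s by exact: f1p.2.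
have F2 : 0 < f2 s by exact: f2p.2.
pose q c (F : R) := (Num.sqrt (F * nuI c))^-1.
have q0 c F : 0 < F -> 0 < q c F by move=> F0; rewrite invr_gt0 sqrtr_gt0 mulr_gt0.
have q2 c F : 0 < F -> q c F ^+ 2 = (F * nuI c)^-1.
  by move=> F0; rewrite exprVn sqr_sqrtr // ltW // mulr_gt0.
pose p c F := Num.sqrt C * expR (- x) * q c F.
have p0 c F : 0 < F -> 0 < p c F.
  by move=> F0; rewrite !mulr_gt0 ?q0 ?sqrtr_gt0 ?expR_gt0.
have p2 c F : 0 < F -> nuI c * p c F ^+ 2 = C / F * expR (- (2 * x)).
  move=> F0; rewrite !exprMn q2 // sqr_sqrtr ?(ltW C0) //.
  rewrite -expRM_natr mulrC [- x * 2]mulrC mulrN invfM.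
  by field; rewrite !gt_eqF.
have qd c f : nneg_pos_function f -> (forall s t, 0 <= s -> s <= t -> f s <= f t) ->
    (forall t, 0 <= t -> (P (iota c) (at_position (iota c) t) <= (f t)%:E^-1)%E) ->
    u c t c <= q c (f s) ^+ 2.
  move=> fp fmono diag; have fs0 : 0 < f s by exact: fp.2.
  rewrite q2 // invfM ler_pdivlMr // mulrC.
  apply: le_trans (on_diagonal t0 fp diag) _.
  by rewrite lef_pV2 ?posrE ?fp.2 // fmono // ltW.
have Ja := tailJ a f1 (d a b) f1p diag1 reg1 grow1 (d_ge0 a b) dt.
have Jb := tailJ b f2 (d a b) f2p diag2 reg2 grow2 (d_ge0 a b) dt.
rewrite -/s -/x -(p2 a _ F1) in Ja; rewrite -/s -/x -(p2 b _ F2) in Jb.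
have := heat_kernel_offdiag nuI_gt0 m_sym m_ge0 k_ge0 d_sym d_triangle
  (u_heat_kernel a) (u_heat_kernel b) (ltW t0) (p0 a _ F1) (q0 a _ F1)
  (p0 b _ F2) (q0 b _ F2) Ja Jb (qd a f1 f1p reg1.1 diag1) (qd b f2 f2p reg2.1 diag2).
have -> : pr (P (iota a)) (killed_position Y tau iota b t) = nuI b * u a t b.
  by rewrite /u mulrCA divff ?mulr1 // gt_eqF.
move=> /(ler_wpM2l (ltW (nuI_gt0 b))) /le_trans; apply.
rewrite le_eqVlt; apply/orP; left; apply/eqP.
rewrite /p /q !sqrtrM ?ltW // sqrtrV ?ltW //.
have nb : nuI b = Num.sqrt (nuI b) ^+ 2 by rewrite sqr_sqrtr // ltW.
rewrite [X in X * _]nb; field.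
by rewrite !gt_eqF ?sqrtr_gt0.
Qed.

End FinitePiece.

Fixpoint ball (x1 x2 : V) (n : nat) : {fset V} :=
  if n is n'.+1 then
    (ball x1 x2 n' `|` \bigcup_(v <- ball x1 x2 n') neighbours E v)%fset
  else [fset x1; x2]%fset.

Lemma ball_mono x1 x2 m n v : (m <= n)%N -> v \in ball x1 x2 m -> v \in ball x1 x2 n.
Proof.
move=> mn; rewrite -(subnK mn); elim: (n - m)%N => //= j IH vm.
by rewrite in_fsetU IH.
Qed.

Lemma ball_exhausts x1 x2 v : exists n, v \in ball x1 x2 n.
Proof.
have [_ fin conn] := graphE; have [p [pE <-]] := conn x1 v.
suff H : forall (p : seq V) y n, y \in ball x1 x2 n -> path E y p ->
    exists n', last y p \in ball x1 x2 n'.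
  by apply: (H p x1 0%N) => //=; rewrite in_fset2 eqxx.
elim=> [|z q IH] y n yn /=; first by exists n.
move=> /andP[yz qz]; apply: (IH z n.+1) => //=.
rewrite in_fsetU; apply/orP; right; apply/bigfcupP; exists y; first by rewrite yn.
by rewrite /neighbours in_fset_set //; exact: mem_set.
Qed.

(** Up to time t only finitely many jumps have been made, so the path stays in
    some ball. *)
Lemma at_position_le x1 x2 (t c : R) :
  (forall (n : nat) (h : x2 \in ball x1 x2 n),
    pr (P x1) (killed_position Y tau (val : ball x1 x2 n -> V) [` h]%fset t) <= c) ->
  (P x1 (at_position x2 t) <= c%:E)%E.
Proof.
move=> H.
have x2n n : x2 \in ball x1 x2 n.
  by apply: (@ball_mono x1 x2 0%N n) => //=; rewrite in_fset2 eqxx orbT.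
pose K n := killed_position Y tau (val : ball x1 x2 n -> V) [` x2n n]%fset t.
have mK n : measurable (K n) by exact: (measurable_killed_position Y_meas tau_meas tau_gt0).
have KU : \bigcup_n K n = at_position x2 t.
  apply/seteqP; split => w.
    by move=> [n _ Kw]; exact: (killed_position_sub Kw).
  move=> [j [Sj Yj]].
  have [g gP] := choice (fun k => ball_exhausts x1 x2 (Y k w)).
  pose n := (\max_(k < j.+1) g k)%N.
  exists n => //; exists j; split => // k kj.
  have Yk : Y k w \in ball x1 x2 n.
    apply: ball_mono (gP k).
    exact: (leq_bigmax (Ordinal (kj : (k < j.+1)%N))).
  by exists [` Yk]%fset.
have ndK : nondecreasing_seq K.
  move=> n n' nn'; apply/subsetPset => w [j [H1 H2 H3]]; exists j; split => //.
  move=> k kj; have [i ->] := H1 k kj.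
  have vi : val i \in ball x1 x2 n' by apply: ball_mono nn' _; exact: valP.
  by exists [` vi]%fset.
have mKU : measurable (\bigcup_n K n) by exact: bigcupT_measurable.
have cK : pr (P x1) (K n) @[n --> \oo] --> pr (P x1) (at_position x2 t).
  apply: fine_cvg; rewrite -prE; last exact: measurable_at_position.
  rewrite -KU; exact: nondecreasing_cvg_mu.
rewrite prE; last exact: measurable_at_position.
rewrite lee_fin; apply: (@cvgr_to_le _ \oo _ _ (fun n => pr (P x1) (K n)) _ _ cK).
by apply: nearW => n; exact: H.
Qed.

End WalkOnGraph.

Theorem theorem5p2 (R : realType) (A gamma epsilon : R)
    (hA : 1 <= A) (hgamma : 1 < gamma) (hepsilon : 0 <= epsilon) :
  exists C1 : R, 0 < C1 /\
  forall (V : choiceType) (E : rel V) (mu : V -> V -> R) (nu : V -> R)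
    (dnu : V -> V -> R)
    (disp : measure_display) (Omega : measurableType disp)
    (P : V -> probability Omega R) (X : R -> Omega -> option V),
  locally_finite_connected_graph E ->
  edge_weight E mu ->
  (forall x, 0 < nu x) ->
  adapted_distance E mu nu dnu ->
  minimal_random_walk mu nu P X ->
  forall (T1 : R) (T2 : \bar R) (x1 x2 : V) (f1 f2 : R -> R),
  0 <= T1 -> (T1%:E < T2)%E ->
  nneg_pos_function f1 -> nneg_pos_function f2 ->
  (forall t, 0 <= t ->
     (P x1 [set w | X t w = Some x1] <= (f1 t)%:E^-1)%E) ->
  (forall t, 0 <= t ->
     (P x2 [set w | X t w = Some x2] <= (f2 t)%:E^-1)%E) ->
  regular_on A gamma f1 T1 T2 ->
  regular_on A gamma f2 T1 T2 ->
  (forall t, T1 <= t -> (t%:E < T2)%E -> f1 t <= A * t `^ epsilon) ->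
  (forall t, T1 <= t -> (t%:E < T2)%E -> f2 t <= A * t `^ epsilon) ->
  forall t : R,
  Num.max (2 ^+ 10 * epsilon * T1 * ln (Num.max T1 1)) (dnu x1 x2) <= t ->
  (t%:E < T2)%E -> 0 < t ->
  (P x1 [set w | X t w = Some x2] <=
   (C1 * Num.sqrt (nu x2 / nu x1)
    / Num.sqrt (f1 (t / (2 * gamma)) * f2 (t / (2 * gamma)))
    * expR (- (10 ^- 7 * (dnu x1 x2 ^+ 2 / t))))%:E)%E.
Proof.
have [C C0 tail] := gaussian_tail hA hgamma hepsilon.
exists (2 * Num.sqrt C); split; first by rewrite mulr_gt0 // sqrtr_gt0.
move=> V E mu nu dnu disp Omega P X graphE weight nu_gt0 adapted [Y [tau [JC XE]]].
move=> T1 T2 x1 x2 f1 f2 T10 T12 f1p f2p diag1 diag2 reg1 reg2 grow1 grow2 t tt tT2 t0.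
have XpE s y : 0 <= s -> [set w | X s w = Some y] = at_position Y tau y s.
  by move=> s0; apply/seteqP; split => w /= /XE; apply.
rewrite (XpE _ _ (ltW t0)).
have diag1' s : 0 <= s -> (P x1 (at_position Y tau x1 s) <= (f1 s)%:E^-1)%E.
  by move=> s0; rewrite -XpE //; exact: diag1.
have diag2' s : 0 <= s -> (P x2 (at_position Y tau x2 s) <= (f2 s)%:E^-1)%E.
  by move=> s0; rewrite -XpE //; exact: diag2.
apply: (at_position_le graphE JC) => n h2.
have h1 : x1 \in ball E x1 x2 n.
  by apply: (@ball_mono _ E x1 x2 0%N n) => //=; rewrite in_fset2 eqxx.
have tl := tail T1 T2 T10 T12.
apply: (@killed_walk_gaussian R V E mu nu dnu disp Omega P Y tau graphE weight nu_gt0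
  adapted JC _ val val_inj A gamma epsilon C T1 T2 [` h1]%fset [` h2]%fset f1 f2 t)
  => //.
Qed.
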